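(* Let $\mathbb S$ be an elementary extension of $\mathbb M$. Suppose that $\mathbb M$ has definable Skolem functions. Let $X$ and $Y$ be definable spaces with $Y$ Hausdorff. Let $f:X\to Y$ be a continuous definable map. Then the following are equivalent: (1) $f$ is definably proper. (2) $f^{\mathbb S}$ is $\mathbb S$-definably proper.
   Context: $\mathbb M=(M,<,\ldots)$ is an arbitrary o-minimal structure; ''definable'' means definable in $\mathbb M$, possibly with parameters. $\mathbb M$ has definable Skolem functions if for every uniformly definable family $\{F_t\}_{t\in T}$ of nonempty definable sets there is a definable map $f:T\to\bigcup_t F_t$ with $f(t)\in F_t$ for all $t\in T$. A definable space is a set $X=\bigcup_{i\le k}X_i$ with injections (definable charts) $\theta_i:X_i\to M^{n_i}$ ($i\le k$, $k$ finite) such that each $\theta_i(X_i)$ is a definable subset of $M^{n_i}$ (with the induced topology), each $\theta_i(X_i\cap X_j)$ is an open definable subset of $\theta_i(X_i)$, and each transition map $\theta_j\circ\theta_i^{-1}:\theta_i(X_i\cap X_j)\to\theta_j(X_i\cap X_j)$ is a definable homeomorphism. $X$ carries the topology in which each $X_i$ is open and each $\theta_i$ is a homeomorphism. A subset $A\subseteq X$ is definable if each $\theta_i(A\cap X_i)$ is definable; it is then itself a definable space with the induced topology. A map $f:X\to Y$ between definable spaces with charts $(X_i,\theta_i)$, $(Y_j,\delta_j)$ is definable if each $\delta_j\circ f\circ\theta_i^{-1}$ (on its natural domain) is a definable map between definable sets. A definable curve in a definable subset $C\subseteq X$ is a continuous definable map $\alpha:(a,b)\to C$, with $a<b$ in $M\cup\{-\infty,+\infty\}$;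 it is completable in $C$ if both limits $\lim_{t\to a^+}\alpha(t)$ and $\lim_{t\to b^-}\alpha(t)$ exist in $C$. $C$ is definably compact if every definable curve in $C$ is completable in $C$. A continuous definable map $f:X\to Y$ is definably proper if $f^{-1}(K)$ is a definably compact definable subset of $X$ for every definably compact definable subset $K$ of $Y$. For an elementary extension $\mathbb S$ of $\mathbb M$, a definable space $X$ gives rise to an $\mathbb S$-definable space $X(\mathbb S)$ (interpret the formulas defining the charts and transition maps in $\mathbb S$), and a continuous definable map $f:X\to Y$ to a continuous $\mathbb S$-definable map $f^{\mathbb S}:X(\mathbb S)\to Y(\mathbb S)$. The prefix ''$\mathbb S$-'' means that the notion is taken in the o-minimal structure $\mathbb S$ (parameters from $\mathbb S$ allowed). *)

(* Defs.v *)
From HB Require Import structures.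
From mathcomp Require Import all_boot all_order all_algebra.
From mathcomp Require Import all_classical topology.

Set Implicit Arguments.
Unset Strict Implicit.
Unset Printing Implicit Defensive.

Import Order.TTheory.
Local Open Scope classical_set_scope.

(* First-order languages expanding {<}; the symbol < is logical (see Lt). *)
Record language := Language {
  fun_sym : Type;
  fun_ar : fun_sym -> nat;
  rel_sym : Type;
  rel_ar : rel_sym -> nat }.

(* [orderTopologicalType] is a linear order with its order topology; 'rV[M]_n
   then carries the product topology. *)
Record structure (L : language) := Structure {
  struct_disp : Order.disp_t;
  universe :> orderTopologicalType struct_disp;
  universe_neq0 : inhabited universe;
  fun_interp : forall f : fun_sym L, 'rV[universe]_(fun_ar f) -> universe;
  rel_interp : forall r : rel_sym L, 'rV[universe]_(rel_ar r) -> Prop }.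

Section syntax.
Variable L : language.

Inductive term (n : nat) : Type :=
| Var of 'I_n
| App (f : fun_sym L) of ('I_(fun_ar f) -> term n).

(* [formula n] has free variables 0, ..., n-1; [Ex] binds variable 0 of its
   body and the remaining variables are shifted by one. *)
Inductive formula (n : nat) : Type :=
| Bot
| Eq of term n & term n
| Lt of term n & term n
| Rel (r : rel_sym L) of ('I_(rel_ar r) -> term n)
| Neg of formula n
| And of formula n & formula n
| Ex of formula (1 + n).

Section semantics.
Variable M : structure L.

Fixpoint eval n (v : 'rV[M]_n) (t : term n) : M :=
  match t with
  | Var i => v ord0 i
  | App f ts => fun_interp (\row_k eval v (ts k))
  end.

Fixpoint sat n (phi : formula n) : 'rV[M]_n -> Prop :=
  match phi with
  | Bot => fun=> False
  | Eq s t => fun v => eval v s = eval v t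
  | Lt s t => fun v => (eval v s < eval v t)%O
  | Rel r ts => fun v => rel_interp (\row_k eval v (ts k))
  | Neg p => fun v => ~ sat p v
  | And p q => fun v => sat p v /\ sat q v
  | Ex p => fun v => exists a : M, sat p (row_mx (const_mx a : 'rV_1) v)
  end.

(* Definable with parameters [p]. *)
Definition definable n (A : set 'rV[M]_n) : Prop :=
  exists m (phi : formula (n + m)) (p : 'rV[M]_m),
    A = [set x | sat phi (row_mx x p)].

Definition definable_map m n (A : set 'rV[M]_m) (g : 'rV[M]_m -> 'rV[M]_n) :=
  definable [set row_mx x (g x) | x in A].

Definition dlo : Prop :=
  (forall x y : M, (x < y)%O -> exists z, (x < z < y)%O) /\
  (forall x : M, exists y z, (y < x < z)%O).

(* Points are the intervals `[a, a]. *)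
Definition o_minimal : Prop :=
  dlo /\
  forall A : set 'rV[M]_1, definable A ->
    exists s : seq (interval M),
      A = [set x | exists2 I, I \in s & x ord0 ord0 \in I].

Definition definable_skolem : Prop :=
  forall m n (T : set 'rV[M]_m) (F : set 'rV[M]_(m + n)),
    definable T -> definable F ->
    (forall t, T t -> exists x, F (row_mx t x)) ->
    exists2 f : 'rV[M]_m -> 'rV[M]_n,
      definable_map T f & forall t, T t -> F (row_mx t (f t)).

End semantics.
End syntax.

Definition elementary L (M S : structure L) (j : M -> S) : Prop :=
  forall n (phi : formula L n) (v : 'rV[M]_n),
    sat phi v <-> sat phi (map_mx j v).

Definition open_in (T : topologicalType) (B A : set T) :=
  exists2 O : set T, open O & A = B `&` O.

Section definable_spaces.
Variables (L : language) (M : structure L).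

(* A chart is a total function of which only the restriction to its domain
   [chdom i] is relevant. The inverse of the transition map from chart i to
   chart j is the transition map from chart j to chart i, so [dtrans], being
   required for all i and j, says that these are definable homeomorphisms. *)
Record dspace := DSpace {
  dcar :> Type;
  nchart : nat;
  cdim : 'I_nchart -> nat;
  chdom : 'I_nchart -> set dcar;
  chart : forall i, dcar -> 'rV[M]_(cdim i);
  dcover : forall x, exists i, chdom i x;
  dinj : forall i x y, chdom i x -> chdom i y -> chart i x = chart i y -> x = y;
  ddef : forall i, definable (chart i @` chdom i);
  dopen : forall i j,
    definable (chart i @` (chdom i `&` chdom j)) /\
    open_in (chart i @` chdom i) (chart i @` (chdom i `&` chdom j));
  dtrans : forall i j,
    let A := chart i @` (chdom i `&` chdom j) in
    exists g : 'rV[M]_(cdim i) -> 'rV[M]_(cdim j),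
      [/\ forall x, chdom i x -> chdom j x -> g (chart i x) = chart j x,
          definable_map A g & {within A, continuous g}] }.

Arguments chdom {d} i : rename.
Arguments chart {d} i : rename.

Section topology.
Variable X : dspace.

Definition dspace_open : set_system X := [set U | forall i : 'I_(nchart X),
  open_in (chart i @` chdom i) (chart i @` (chdom i `&` U))].

Lemma dspace_open_pre (U : set X) : dspace_open U <->
  forall i, exists2 O, open O & forall x, chdom i x -> U x <-> O (chart i x).
Proof.
split=> H i.
  have [O oO E] := H i; exists O => // x xi; split=> [Ux|Ox].
    by have : (chart i @` chdom i `&` O) (chart i x);
      [rewrite -E; exists x|case].
  have : (chart i @` (chdom i `&` U)) (chart i x).
    by rewrite E; split => //; exists x.
  by case=> y [yi Uy] /(dinj yi xi) <-.
have [O oO E] := H i; exists O => //; apply/seteqP; split=> u.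
  by case=> x [xi Ux] <-; split; [exists x|apply/(E _ xi)].
by case=> -[x xi <-] Ox; exists x => //; split=> //; apply/(E _ xi).
Qed.

Lemma dspace_openT : dspace_open setT.
Proof. by apply/dspace_open_pre => i; exists setT => //; exact: openT. Qed.

Lemma dspace_openI : setI_closed dspace_open.
Proof.
move=> U V /dspace_open_pre oU /dspace_open_pre oV.
apply/dspace_open_pre => i; have [O oO EO] := oU i; have [P oP EP] := oV i.
exists (O `&` P); first exact: openI.
by move=> x xi; split=> -[] /(EO _ xi) ? /(EP _ xi) ?.
Qed.

Lemma dspace_open_bigU (I : Type) (F : I -> set X) :
  (forall i, dspace_open (F i)) -> dspace_open (\bigcup_i F i).
Proof.
move=> oF; apply/dspace_open_pre => i.
have /choice [O HO] : forall k, exists O, open O /\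
    forall x, chdom i x -> F k x <-> O (chart i x).
  by move=> k; have /dspace_open_pre/(_ i)[O] := oF k; exists O.
exists (\bigcup_k O k); first by apply: bigcup_open => k _; case: (HO k).
move=> x xi; split=> -[k _ Hk]; exists k => //;
  by have [_ /(_ x xi) []] := HO k; auto.
Qed.

HB.instance Definition _ := gen_eqMixin (dcar X).
HB.instance Definition _ := gen_choiceMixin (dcar X).
HB.instance Definition _ := isOpenTopological.Build (dcar X)
  dspace_openT dspace_openI dspace_open_bigU.

End topology.

Definition definable_sub (X : dspace) (A : set X) : Prop :=
  forall i : 'I_(nchart X), definable (chart i @` (A `&` chdom i)).

Definition fun_graph (X Y : dspace) (f : X -> Y)
    (i : 'I_(nchart X)) (j : 'I_(nchart Y)) :
    set 'rV[M]_(cdim i + cdim j) :=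
  [set row_mx (chart i x) (chart j (f x)) |
    x in chdom i `&` f @^-1` chdom j].
Arguments fun_graph {X Y} f i j.

Definition definable_fun (X Y : dspace) (f : X -> Y) : Prop :=
  forall i j, definable (fun_graph f i j).

(* Endpoints in M with both infinities: [None] is -oo as a left endpoint and
   +oo as a right endpoint. *)
Definition lower_end (a : option M) : itv_bound M :=
  if a is Some x then BRight x else -oo%O.
Definition upper_end (b : option M) : itv_bound M :=
  if b is Some x then BLeft x else +oo%O.

Definition open_itv (a b : option M) : set M :=
  [set` Interval (lower_end a) (upper_end b)].

Definition right_of (a : option M) : set_system M :=
  filter_from [set c | (lower_end a < BLeft c)%O]
    (fun c => open_itv a (Some c)).
Definition left_of (b : option M) : set_system M :=
  filter_from [set c | (BRight c < upper_end b)%O]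
    (fun c => open_itv (Some c) b).

Section compact.
Variable X : dspace.

(* The values of alpha outside of the interval are irrelevant. *)
Definition definable_curve (C : set X) (a b : option M) (alpha : M -> X) :=
  [/\ (lower_end a < upper_end b)%O,
      {homo alpha : t / open_itv a b t >-> C t},
      {within open_itv a b, continuous alpha} &
      forall i : 'I_(nchart X),
        definable [set row_mx (const_mx t : 'rV_1) (chart i (alpha t)) |
          t in open_itv a b `&` alpha @^-1` chdom i]].

Definition completable (C : set X) (a b : option M) (alpha : M -> X) :=
  (exists2 x, C x & alpha @ right_of a --> x) /\
  (exists2 x, C x & alpha @ left_of b --> x).

Definition definably_compact (C : set X) : Prop :=
  forall a b alpha, definable_curve C a b alpha -> completable C a b alpha.

End compact.

Definition definably_proper (X Y : dspace) (f : X -> Y) : Prop :=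
  forall K : set Y, definable_sub K -> definably_compact K ->
    definable_sub (f @^-1` K) /\ definably_compact (f @^-1` K).

End definable_spaces.

Arguments chdom {L M d} i : rename.
Arguments chart {L M d} i : rename.
Arguments fun_graph {L M X Y} f i j.

Section renaming.
Variable L : language.

Fixpoint tren m n (f : 'I_m -> 'I_n) (t : term L m) : term L n :=
  match t with
  | Var i => Var L (f i)
  | App g ts => App (fun k => tren f (ts k))
  end.

Definition up m n (f : 'I_m -> 'I_n) (k : 'I_(1 + m)) : 'I_(1 + n) :=
  match fintype.split k with inl a => lshift n a | inr b => rshift 1 (f b) end.

Fixpoint ren m (phi : formula L m) : forall n, ('I_m -> 'I_n) -> formula L n :=
  match phi with
  | Bot => fun n _ => Bot L n
  | Eq s t => fun n f => Eq (tren f s) (tren f t)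
  | Lt s t => fun n f => Lt (tren f s) (tren f t)
  | Rel r ts => fun n f => Rel (fun k => tren f (ts k))
  | Neg p => fun n f => Neg (ren p f)
  | And p q => fun n f => And (ren p f) (ren q f)
  | Ex p => fun n f => Ex (ren p (up f))
  end.

Fixpoint exs n m : formula L (n + m) -> formula L m :=
  match n with
  | 0 => fun phi => phi
  | n'.+1 => fun phi => exs (Ex (phi : formula L (1 + (n' + m))))
  end.

Definition sel (T : Type) m n (f : 'I_m -> 'I_n) (v : 'rV[T]_n) : 'rV[T]_m :=
  \row_i v ord0 (f i).

Lemma row_mxl (T : Type) m n (u : 'rV[T]_m) (v : 'rV[T]_n) i :
  row_mx u v ord0 (lshift n i) = u ord0 i.
Proof. by rewrite row_mxEl. Qed.

Lemma row_mxr (T : Type) m n (u : 'rV[T]_m) (v : 'rV[T]_n) i :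
  row_mx u v ord0 (rshift m i) = v ord0 i.
Proof. by rewrite row_mxEr. Qed.

Lemma sel_up (T : Type) m n (f : 'I_m -> 'I_n) (a : 'rV[T]_1) v :
  sel (up f) (row_mx a v) = row_mx a (sel f v).
Proof.
apply/rowP => k; rewrite mxE /up; case: splitP => i ik.
- have -> : k = lshift m i by apply/val_inj.
  by rewrite !row_mxl.
- have -> : k = rshift 1 i by apply/val_inj.
  by rewrite !row_mxr mxE.
Qed.

Lemma row_mx0 (T : Type) m (x : 'rV[T]_0) (v : 'rV[T]_m) :
  row_mx x v = v :> 'rV_m.
Proof.
apply/rowP => k; have := row_mxr x v k; congr (_ = _).
by congr (row_mx x v ord0 _); apply/val_inj.
Qed.

Lemma row_mx1A (T : Type) n m (a : 'rV[T]_1) (x : 'rV[T]_n) (v : 'rV[T]_m) :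
  row_mx a (row_mx x v) = row_mx (row_mx a x) v :> 'rV_(1 + (n + m)).
Proof.
rewrite row_mxA; set e := (X in castmx X _).
by case: e => e1 e2; rewrite (eq_irrelevance e1 erefl) (eq_irrelevance e2 erefl).
Qed.

Variable M : structure L.

Lemma eval_tren m n (f : 'I_m -> 'I_n) (t : term L m) (v : 'rV[M]_n) :
  eval v (tren f t) = eval (sel f v) t.
Proof.
elim: t => [i|g ts IH] /=; first by rewrite mxE.
by congr fun_interp; apply/rowP => k; rewrite !mxE IH.
Qed.

Lemma sat_ren m (phi : formula L m) n (f : 'I_m -> 'I_n) (v : 'rV[M]_n) :
  sat (ren phi f) v <-> sat phi (sel f v).
Proof.
elim: phi n f v => {m} [m|m s t|m s t|m r ts|m p IH|m p IHp q IHq|m p IH]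
  n f v /=.
- by [].
- by rewrite !eval_tren.
- by rewrite !eval_tren.
- have -> : (\row_k eval v (tren f (ts k)) = \row_k eval (sel f v) (ts k)
    :> 'rV[M]_(rel_ar r))%R.
    by apply/rowP => k; rewrite !mxE eval_tren.
  by [].
- by rewrite IH.
- by rewrite IHp IHq.
- split=> -[a Ha]; exists a.
  + by rewrite -sel_up; apply/IH.
  + by apply/IH; rewrite sel_up.
Qed.

Lemma sat_exs n m (phi : formula L (n + m)) (v : 'rV[M]_m) :
  sat (exs phi) v <-> exists x, sat phi (row_mx x v).
Proof.
elim: n phi => [|n IH] phi /=.
  split=> [H|[x]]; last by rewrite row_mx0.
  by case: (universe_neq0 M) => a; exists (const_mx a); rewrite row_mx0.
rewrite IH; split=> /= -[x].
  by case=> a; exists (row_mx (const_mx a : 'rV_1) x); rewrite -row_mx1A.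
move: x => x0; pose x : 'rV[M]_(1 + n) := x0; rewrite -[x0]/x => H.
exists (rsubmx x), (x ord0 ord0).
suff E : row_mx (const_mx (x ord0 ord0)) (rsubmx x) = x by rewrite row_mx1A E.
rewrite -[RHS]hsubmxK; congr row_mx.
by apply/rowP => k; rewrite !mxE [k]ord1; congr (x _ _); apply/val_inj.
Qed.

End renaming.

Section boxes.
Variables (L : language) (T : structure L).

Definition box n (l r w : 'rV[T]_n) : Prop :=
  forall i, (l ord0 i < w ord0 i)%O /\ (w ord0 i < r ord0 i)%O.

Definition no_ends : Prop := forall w : 'rV[T]_1, exists l r, box l r w.

Lemma dlo_no_ends : dlo T -> no_ends.
Proof.
move=> [_ H] w; have [y [z /andP[yx xz]]] := H (w ord0 ord0).
by exists (const_mx y), (const_mx z) => i; rewrite [i]ord1 !mxE.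
Qed.

Hypothesis ne : no_ends.

Lemma nbhs_itv (x : T) (U : set T) : nbhs x U ->
  exists l r : T, (l < x)%O /\ (x < r)%O /\
    forall y, (l < y)%O -> (y < r)%O -> U y.
Proof.
have [l0 [r0 /(_ ord0)]] := ne (const_mx x); rewrite !mxE => -[l0x xr0].
rewrite itv_nbhsE => -[[a b] [/= oi xi] sU].
have [l [lx Hl]] : exists l, (l < x)%O /\ forall y, (l < y)%O -> (a <= BLeft y)%O.
  case: a oi xi {sU} => [c a|c].
    case: c => oi; first by case: b oi => [[] ?|[]].
    rewrite in_itv /= => /andP[ax _]; by exists a.
  case: c => oi; last by rewrite in_itv.
  by exists (l0 ord0 ord0); split.
have [r [xr Hr]] : exists r, (x < r)%O /\ forall y, (y < r)%O -> (BRight y <= b)%O.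
  case: b oi xi {sU} => [c b|c].
    case: c => oi; last by move: oi; case: (a) => [[] ?|[]].
    rewrite in_itv /= => /andP[_ xb]; by exists b.
  case: c => oi; first by rewrite in_itv /= andbF.
  by exists (r0 ord0 ord0); split.
exists l, r; do 2!split=> //; move=> y ly yr; apply: sU => /=.
by rewrite itv_boundlr Hl // Hr.
Qed.

Lemma nbhs_box n (u : 'rV[T]_n) (U : set 'rV[T]_n) :
  nbhs u U <-> exists l r, box l r u /\ forall w, box l r w -> U w.
Proof.
split=> [[P uP sU]|[l [r [ub sU]]]]; last first.
  exists (fun _ i => `]l ord0 i, r ord0 i[%classic) => [k i|w Hw].
    rewrite [k]ord1; apply: open_nbhs_nbhs; split; first exact: itv_open.
    by rewrite /= in_itv /=; apply/andP; exact: ub.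
  by apply: sU => i; have := Hw ord0 i; rewrite /= in_itv /= => /andP.
have /choice [l Hl] : forall i, exists l, exists r : T, (l < u ord0 i)%O /\
    (u ord0 i < r)%O /\ forall y, (l < y)%O -> (y < r)%O -> P ord0 i y.
  by move=> i; exact: nbhs_itv (uP ord0 i).
have /choice [r Hr] := Hl.
exists (\row_i l i)%R, (\row_i r i)%R; split=> [i|w Hw].
  by rewrite !mxE; have [? []] := Hr i.
apply: sU => k i; rewrite [k]ord1; have [_ [_]] := Hr i.
by have := Hw i; rewrite !mxE => -[? ?]; apply.
Qed.

Lemma open_inP n (B A : set 'rV[T]_n) : open_in B A <->
  (forall u, A u -> B u) /\
  (forall u, A u -> exists l r, box l r u /\
    forall w, B w -> box l r w -> A w).
Proof.
split=> [[O oO ->]|[sAB H]].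
  split=> [u []//|u [Bu Ou]].
  have /nbhs_box [l [r [ub sO]]] : nbhs u O by apply: open_nbhs_nbhs.
  by exists l, r; split=> // w Bw /sO.
exists [set w | exists l r, box l r w /\ forall w', B w' -> box l r w' -> A w'].
  rewrite openE => w [l [r [wb sA]]]; apply/nbhs_box.
  by exists l, r; split=> // w' w'b; exists l, r.
apply/seteqP; split=> [u Au|u [Bu [l [r [ub]]]]]; last exact.
by split; [exact: sAB|exact: H].
Qed.

Lemma within_contP m n (A : set 'rV[T]_m) (g : 'rV[T]_m -> 'rV[T]_n) :
  {within A, continuous g} <->
  (forall u, A u -> forall l r, box l r (g u) -> exists l' r', box l' r' u /\
    forall u', A u' -> box l' r' u' -> box l r (g u')).
Proof.
rewrite subspace_continuousP; split=> H u Au.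
  move=> l r gub.
  have /(H u Au) : nbhs (g u) (box l r) by apply/nbhs_box; exists l, r.
  rewrite /= /nbhs /= /within /= => /nbhs_box[l' [r' [ub sub]]].
  by exists l', r'; split=> // u' Au' /sub; exact.
move=> V /nbhs_box[l [r [gub sV]]].
have [l' [r' [ub sub]]] := H u Au l r gub.
rewrite /= /nbhs /= /within /=; apply/nbhs_box; exists l', r'; split=> // w wb Aw.
by apply: sV; exact: sub.
Qed.

End boxes.

Section transfer.
Variables (L : language) (M S : structure L) (j : M -> S).
Hypothesis jel : elementary j.

(* P and Q are the interpretations in M and in S of a formula with parameters
   in M. *)
Definition tr n (P : 'rV[M]_n -> Prop) (Q : 'rV[S]_n -> Prop) : Prop :=
  exists m (phi : formula L (n + m)) (p : 'rV[M]_m),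
    (forall w, P w <-> sat phi (row_mx w p)) /\
    (forall w, Q w <-> sat phi (row_mx w (map_mx j p))).

Lemma tr_transfer n P Q : @tr n P Q -> (forall w, P w) <-> (forall w, Q w).
Proof.
move=> [m [phi [p [HP HQ]]]].
have [E1 E2] := jel (Neg (exs (Neg phi))) p.
rewrite /= !sat_exs /= in E1 E2.
split=> H w.
  apply/HQ; apply: contrapT => N; apply: E1; last by exists w.
  by case=> x; apply; apply/HP.
apply/HP; apply: contrapT => N; apply: E2; last by exists w.
by case=> x; apply; apply/HQ.
Qed.

Lemma tr_pt n P Q w : @tr n P Q -> P w <-> Q (map_mx j w).
Proof.
by move=> [m [phi [p [HP HQ]]]]; rewrite HP HQ jel map_row_mx.
Qed.

Lemma tr_ext n P P' Q Q' : (forall w, P w <-> P' w) ->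
  (forall w, Q w <-> Q' w) -> @tr n P Q -> @tr n P' Q'.
Proof.
move=> EP EQ [m [phi [p [HP HQ]]]]; exists m, phi, p.
by split=> w; rewrite -?EP -?EQ.
Qed.

Lemma tr_not n P Q : @tr n P Q -> tr (fun w => ~ P w) (fun w => ~ Q w).
Proof.
move=> [m [phi [p [HP HQ]]]]; exists m, (Neg phi), p.
by split=> w /=; rewrite ?HP ?HQ.
Qed.

Lemma tr_and n P Q P' Q' : @tr n P Q -> @tr n P' Q' ->
  tr (fun w => P w /\ P' w) (fun w => Q w /\ Q' w).
Proof.
move=> [m [phi [p [HP HQ]]]] [m' [phi' [p' [HP' HQ']]]].
pose f (k : 'I_(n + m)) : 'I_(n + (m + m')) :=
  match fintype.split k with inl a => lshift _ a | inr b => rshift n (lshift _ b) end.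
pose f' (k : 'I_(n + m')) : 'I_(n + (m + m')) :=
  match fintype.split k with inl a => lshift _ a | inr b => rshift n (rshift m b) end.
have Ef (T : Type) (w : 'rV[T]_n) (a : 'rV[T]_m) (b : 'rV[T]_m') :
    sel f (row_mx w (row_mx a b)) = row_mx w a.
  apply/rowP => k; rewrite mxE /f.
  by rewrite -[k in RHS]splitK; case: (fintype.split k) => i /=; rewrite !(row_mxl, row_mxr).
have Ef' (T : Type) (w : 'rV[T]_n) (a : 'rV[T]_m) (b : 'rV[T]_m') :
    sel f' (row_mx w (row_mx a b)) = row_mx w b.
  apply/rowP => k; rewrite mxE /f'.
  by rewrite -[k in RHS]splitK; case: (fintype.split k) => i /=; rewrite !(row_mxl, row_mxr).
exists (m + m'), (And (ren phi f) (ren phi' f')), (row_mx p p').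
by split=> w /=; rewrite ?map_row_mx !sat_ren Ef Ef' ?HP ?HQ ?HP' ?HQ'.
Qed.

Lemma tr_or n P Q P' Q' : @tr n P Q -> @tr n P' Q' ->
  tr (fun w => P w \/ P' w) (fun w => Q w \/ Q' w).
Proof.
move=> H H'; apply: tr_ext (tr_not (tr_and (tr_not H) (tr_not H'))) => w;
  by split=> [/not_andP[]/contrapT|]; tauto.
Qed.

Lemma tr_imp n P Q P' Q' : @tr n P Q -> @tr n P' Q' ->
  tr (fun w => P w -> P' w) (fun w => Q w -> Q' w).
Proof.
move=> H H'; apply: tr_ext (tr_not (tr_and H (tr_not H'))) => w; split.
- by move=> N p; apply: contrapT => p'; apply: N.
- by move=> N [p]; apply; apply: N.
- by move=> N p; apply: contrapT => p'; apply: N.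
- by move=> N [p]; apply; apply: N.
Qed.

Lemma tr_sel m n (f : 'I_m -> 'I_n) P Q : @tr m P Q ->
  tr (fun w => P (sel f w)) (fun w => Q (sel f w)).
Proof.
move=> [k [phi [p [HP HQ]]]].
pose g (i : 'I_(m + k)) : 'I_(n + k) :=
  match fintype.split i with inl a => lshift _ (f a) | inr b => rshift n b end.
have Eg (T : Type) (w : 'rV[T]_n) (a : 'rV[T]_k) :
    sel g (row_mx w a) = row_mx (sel f w) a.
  apply/rowP => i; rewrite mxE /g.
  rewrite -[i in RHS]splitK; case: (fintype.split i) => i' /=;
  by rewrite !(row_mxl, row_mxr) ?mxE.
exists k, (ren phi g), p.
by split=> w; rewrite sat_ren Eg ?HP ?HQ.
Qed.

Lemma tr_ex k n (P : 'rV[M]_k -> 'rV[M]_n -> Prop)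
    (Q : 'rV[S]_k -> 'rV[S]_n -> Prop) :
  @tr (k + n) (fun w => P (lsubmx w) (rsubmx w))
              (fun w => Q (lsubmx w) (rsubmx w)) ->
  tr (fun w => exists x, P x w) (fun w => exists x, Q x w).
Proof.
move=> [m [phi [p [HP HQ]]]].
pose g (i : 'I_((k + n) + m)) : 'I_(k + (n + m)) := cast_ord (esym (addnA _ _ _)) i.
have Eg (T : Type) (x : 'rV[T]_k) (w : 'rV[T]_n) (a : 'rV[T]_m) :
    sel g (row_mx x (row_mx w a)) = row_mx (row_mx x w) a.
  apply/rowP => i; rewrite mxE row_mxA castmxE /=; congr (row_mx _ _ _ _).
    exact/val_inj.
  exact/val_inj.
exists m, (exs (ren phi g)), p.
split=> w; rewrite sat_exs; split=> -[x Hx]; exists x; move: Hx.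
- by rewrite sat_ren Eg -HP row_mxKl row_mxKr.
- by rewrite sat_ren Eg -HP row_mxKl row_mxKr.
- by rewrite sat_ren Eg -HQ row_mxKl row_mxKr.
- by rewrite sat_ren Eg -HQ row_mxKl row_mxKr.
Qed.

Lemma tr_all k n (P : 'rV[M]_k -> 'rV[M]_n -> Prop)
    (Q : 'rV[S]_k -> 'rV[S]_n -> Prop) :
  @tr (k + n) (fun w => P (lsubmx w) (rsubmx w))
              (fun w => Q (lsubmx w) (rsubmx w)) ->
  tr (fun w => forall x, P x w) (fun w => forall x, Q x w).
Proof.
move=> H.
have := @tr_ex k n (fun x w => ~ P x w) (fun x w => ~ Q x w) (tr_not H).
move/tr_not; apply: tr_ext => w; split.
- by move=> N x; apply: contrapT => p; apply: N; exists x.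
- by move=> N [x]; apply; apply: N.
- by move=> N x; apply: contrapT => p; apply: N; exists x.
- by move=> N [x]; apply; apply: N.
Qed.

Lemma tr_lt n (a b : 'I_n) :
  @tr n (fun w => (w ord0 a < w ord0 b)%O) (fun w => (w ord0 a < w ord0 b)%O).
Proof.
case: (universe_neq0 M) => x0.
exists 0, (Lt (Var L (lshift 0 a)) (Var L (lshift 0 b))), (const_mx x0).
by split=> w /=; rewrite !row_mxl.
Qed.

Lemma tr_eq1 n (a b : 'I_n) :
  @tr n (fun w => w ord0 a = w ord0 b) (fun w => w ord0 a = w ord0 b).
Proof.
case: (universe_neq0 M) => x0.
exists 0, (Eq (Var L (lshift 0 a)) (Var L (lshift 0 b))), (const_mx x0).
by split=> w /=; rewrite !row_mxl.
Qed.

Lemma tr_false n : @tr n (fun=> False) (fun=> False).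
Proof.
case: (universe_neq0 M) => x0.
by exists 0, (Bot L _), (const_mx x0); split.
Qed.

Lemma tr_true n : @tr n (fun=> True) (fun=> True).
Proof. by apply: tr_ext (tr_not (tr_false n)) => w; tauto. Qed.

Lemma tr_ord_ex k n (P : 'I_k -> 'rV[M]_n -> Prop) (Q : 'I_k -> 'rV[S]_n -> Prop) :
  (forall i, tr (P i) (Q i)) ->
  tr (fun w => exists i, P i w) (fun w => exists i, Q i w).
Proof.
elim: k P Q => [|k IH] P Q H.
  by apply: tr_ext (tr_false n) => w; split => // -[[]].
apply: tr_ext (tr_or (H ord0) (IH (fun i => P (lift ord0 i))
  (fun i => Q (lift ord0 i)) (fun i => H _))) => w.
- split=> [[h|[i h]]|[i]]; [by exists ord0|by exists (lift ord0 i)|].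
  by case: (unliftP ord0 i) => [i'|] ->; [right; exists i'|left].
- split=> [[h|[i h]]|[i]]; [by exists ord0|by exists (lift ord0 i)|].
  by case: (unliftP ord0 i) => [i'|] ->; [right; exists i'|left].
Qed.

Lemma tr_ord_all k n (P : 'I_k -> 'rV[M]_n -> Prop) (Q : 'I_k -> 'rV[S]_n -> Prop) :
  (forall i, tr (P i) (Q i)) ->
  tr (fun w => forall i, P i w) (fun w => forall i, Q i w).
Proof.
move=> H.
have := @tr_ord_ex k n (fun i w => ~ P i w) (fun i w => ~ Q i w)
  (fun i => tr_not (H i)).
move/tr_not; apply: tr_ext => w; split.
- by move=> N x; apply: contrapT => p; apply: N; exists x.
- by move=> N [x]; apply; apply: N.
- by move=> N x; apply: contrapT => p; apply: N; exists x.
- by move=> N [x]; apply; apply: N.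
Qed.

(* The same selection of coordinates over M and over S. *)
Definition selp m n (a : 'rV[M]_n -> 'rV[M]_m) (b : 'rV[S]_n -> 'rV[S]_m) :=
  exists f : 'I_m -> 'I_n, (forall w, a w = sel f w) /\ (forall w, b w = sel f w).

Lemma selp_id n : @selp n n (fun w => w) (fun w => w).
Proof. by exists id; split=> w; apply/rowP => i; rewrite mxE. Qed.

Lemma selp_lsub k m n a b : @selp (k + m) n a b ->
  selp (fun w => lsubmx (a w)) (fun w => lsubmx (b w)).
Proof.
move=> [f [Ha Hb]]; exists (f \o lshift m).
by split=> w; apply/rowP => i; rewrite !mxE ?Ha ?Hb mxE.
Qed.

Lemma selp_rsub k m n a b : @selp (k + m) n a b ->
  selp (fun w => rsubmx (a w)) (fun w => rsubmx (b w)).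
Proof.
move=> [f [Ha Hb]]; exists (f \o @rshift k m).
by split=> w; apply/rowP => i; rewrite !mxE ?Ha ?Hb mxE.
Qed.

Lemma selp_row k m n a b c d : @selp k n a b -> @selp m n c d ->
  selp (fun w => row_mx (a w) (c w)) (fun w => row_mx (b w) (d w)).
Proof.
move=> [f [Ha Hb]] [g [Hc Hd]].
exists (fun i => match fintype.split i with inl k => f k | inr k => g k end).
split=> w; apply/rowP => i; rewrite [in RHS]mxE;
  rewrite -[i in LHS]splitK; case: (fintype.split i) => i' /=;
  by rewrite (row_mxl, row_mxr) ?Ha ?Hb ?Hc ?Hd mxE.
Qed.

Lemma tr_comp m n a b P Q : @selp m n a b -> tr P Q ->
  tr (fun w => P (a w)) (fun w => Q (b w)).
Proof.
move=> [f [Ha Hb]] /(tr_sel f).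
by apply: tr_ext => w; rewrite ?Ha ?Hb.
Qed.

Lemma tr_eq m n a b c d : @selp m n a b -> @selp m n c d ->
  tr (fun w => a w = c w) (fun w => b w = d w).
Proof.
move=> [f [Ha Hb]] [g [Hc Hd]].
apply: tr_ext (tr_ord_all (fun i => tr_eq1 (f i) (g i))) => w;
  rewrite ?Ha ?Hb ?Hc ?Hd.
- split=> [H|/rowP H i]; first by apply/rowP => i; rewrite !mxE.
  by have := H i; rewrite !mxE.
- split=> [H|/rowP H i]; first by apply/rowP => i; rewrite !mxE.
  by have := H i; rewrite !mxE.
Qed.

Lemma tr_box m n a a' b b' c c' :
  @selp m n a a' -> @selp m n b b' -> @selp m n c c' ->
  tr (fun w => box (a w) (b w) (c w)) (fun w => box (a' w) (b' w) (c' w)).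
Proof.
move=> [f [Hf Hf']] [g [Hg Hg']] [h [Hh Hh']].
apply: tr_ext (tr_ord_all (fun i => tr_and (tr_lt (f i) (h i))
  (tr_lt (h i) (g i)))) => w; rewrite ?Hf ?Hf' ?Hg ?Hg' ?Hh ?Hh'.
- by split=> H i; have := H i; rewrite !mxE.
- by split=> H i; have := H i; rewrite !mxE.
Qed.

Lemma tr_sent (P Q : Prop) :
  tr (fun _ : 'rV[M]_0 => P) (fun _ : 'rV[S]_0 => Q) -> P <-> Q.
Proof.
case: (universe_neq0 M) (universe_neq0 S) => x0 [y0] /tr_transfer [H1 H2].
by split=> H; [apply: H1 (const_mx y0)|apply: H2 (const_mx x0)].
Qed.

(* The interpretation A(S) in S of a set A definable in M: all the formulas
   defining A in M define the same set in S (lemma extE). *)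
Definition ext n (A : set 'rV[M]_n) : set 'rV[S]_n :=
  [set x | exists m (phi : formula L (n + m)) (p : 'rV[M]_m),
    A = [set y | sat phi (row_mx y p)] /\ sat phi (row_mx x (map_mx j p))].

Lemma tr_uniq n P Q Q' : @tr n P Q -> @tr n P Q' -> forall w, Q w <-> Q' w.
Proof.
move=> H H'; have HH := tr_and (tr_imp H H') (tr_imp H' H).
by move/(tr_transfer HH): (fun w : 'rV[M]_n => conj (@id (P w)) (@id (P w))).
Qed.

Lemma extE n m (phi : formula L (n + m)) (p : 'rV[M]_m) :
  ext [set y | sat phi (row_mx y p)] =
  [set x | sat phi (row_mx x (map_mx j p))].
Proof.
apply/seteqP; split=> x; last by exists m, phi, p.
move=> [m' [phi' [p' [E Hx]]]].
apply/(@tr_uniq n (fun y => sat phi (row_mx y p)) _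
  (fun y => sat phi' (row_mx y (map_mx j p')))) => //.
  by exists m, phi, p.
exists m', phi', p'; split => // w.
by have : [set y | sat phi (row_mx y p)] w <-> [set y | sat phi' (row_mx y p')] w
  by rewrite E.
Qed.

Lemma tr_def n (A : set 'rV[M]_n) : definable A -> tr A (ext A).
Proof.
move=> [m [phi [p ->]]]; exists m, phi, p; split=> // w.
by rewrite extE.
Qed.

Lemma ext_definable n (A : set 'rV[M]_n) : definable A -> definable (ext A).
Proof.
by move=> [m [phi [p ->]]]; exists m, phi, (map_mx j p); rewrite extE.
Qed.

Lemma tr_extE n A Q : @tr n A Q -> ext A = Q.
Proof.
move=> H; have dA : definable A.
  case: H => m [phi [p [HP _]]]; exists m, phi, p.
  by apply/seteqP; split=> w /HP.
by apply/seteqP; split=> w /(tr_uniq (tr_def dA) H w).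
Qed.

End transfer.

Section space_facts.
Variables (L : language) (M : structure L) (X : dspace M).

Definition trg (i j : 'I_(nchart X)) : set 'rV[M]_(cdim i + cdim j) :=
  [set row_mx (chart i x) (chart j x) | x in chdom i `&` chdom j].
Arguments trg : clear implicits.

Lemma trgP i j u v : trg i j (row_mx u v) <->
  exists x, [/\ chdom i x, chdom j x, chart i x = u & chart j x = v].
Proof.
split=> [[x [xi xj] /eq_row_mx[]]|[x [xi xj <- <-]]]; first by exists x.
by exists x.
Qed.

Lemma trg_definable i j : definable (trg i j).
Proof.
have [g [Hg [m [phi [p E]]] _]] := dtrans i j.
exists m, phi, p; rewrite -E; apply/seteqP; split=> w.
  by case=> x [xi xj] <-; exists (chart i x); [exists x|rewrite Hg].
by case=> u [x [xi xj] <-] <-; exists x => //; rewrite Hg.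
Qed.

Lemma trg_diag i u v :
  trg i i (row_mx u v) <-> (chart i @` chdom i) u /\ u = v.
Proof.
rewrite trgP; split=> [[x [xi _ <- <-]]|[[x xi <-] <-]].
  by split=> //; exists x.
by exists x.
Qed.

Lemma trg_sym i j u v : trg i j (row_mx u v) -> trg j i (row_mx v u).
Proof. by move=> /trgP[x [? ? ? ?]]; apply/trgP; exists x. Qed.

Lemma trg_trans i j k u v w :
  trg i j (row_mx u v) -> trg j k (row_mx v w) -> trg i k (row_mx u w).
Proof.
move=> /trgP[x [xi xj <- <-]] /trgP[y [yj yk E <-]].
by apply/trgP; exists x; rewrite (dinj yj xj E) in yk *.
Qed.

Lemma trg_ov i j u :
  (chart i @` (chdom i `&` chdom j)) u <-> exists v, trg i j (row_mx u v).
Proof.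
split=> [[x [xi xj] <-]|[v /trgP[x [xi xj <- _]]]]; last by exists x.
by exists (chart j x); apply/trgP; exists x.
Qed.

Hypothesis ne : no_ends M.

Lemma trg_open i j u v : trg i j (row_mx u v) -> exists l r, box l r u /\
  forall u', (chart i @` chdom i) u' -> box l r u' ->
    exists v', trg i j (row_mx u' v').
Proof.
move=> uv; have [_ /(open_inP ne)[_ /(_ u)]] := dopen i j.
have /[swap] /[apply] : (chart i @` (chdom i `&` chdom j)) u.
  by apply/trg_ov; exists v.
move=> [l [r [ub H]]]; exists l, r; split=> // u' Uu' bu'.
by apply/trg_ov; exact: H.
Qed.

Lemma trg_cont i j u v : trg i j (row_mx u v) -> forall l r, box l r v ->
  exists l' r', box l' r' u /\
  forall u' v', trg i j (row_mx u' v') -> box l' r' u' -> box l r v'.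
Proof.
move=> /[dup] uv /trgP[x [xi xj xu xv]] l r vb.
have [g [Hg _ /(within_contP ne) H]] := dtrans i j.
have /H : (chart i @` (chdom i `&` chdom j)) u by exists x.
rewrite -xu Hg // xv => /(_ l r vb) [l' [r' [ub sub]]].
exists l', r'; split=> // u' v' /trgP[x' [x'i x'j <- <-]] /sub.
by rewrite Hg //; apply; exists x'.
Qed.

(* The domains of the charts are open and the charts are homeomorphisms onto
   their images. *)
Lemma nbhs_chart (i : 'I_(nchart X)) (x : X) (U : set X) : chdom i x ->
  nbhs x U <-> exists l r, box l r (chart i x) /\
    forall x', chdom i x' -> box l r (chart i x') -> U x'.
Proof.
move=> xi; split=> [|[l [r [xb sU]]]].
  rewrite nbhsE => -[V [oV Vx] sV].
  have /dspace_open_pre/(_ i)[O oO E] : dspace_open V by move: oV.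
  have /(nbhs_box ne)[l [r [xb sO]]] : nbhs (chart i x) O.
    by apply: open_nbhs_nbhs; split=> //; apply/(E _ xi).
  by exists l, r; split=> // x' x'i /sO /(E _ x'i) /sV.
rewrite nbhsE; exists [set x' | chdom i x' /\ box l r (chart i x')].
  split=> //; suff : dspace_open [set x' | chdom i x' /\ box l r (chart i x')].
    by [].
  move=> k; apply/(open_inP ne); split=> [u [y [yk _] <-]|u [y [yk [yi yb]] <-]].
    by exists y.
  have yki : trg k i (row_mx (chart k y) (chart i y)) by apply/trgP; exists y.
  have [l1 [r1 [b1 H1]]] := trg_open yki.
  have [l2 [r2 [b2 H2]]] := trg_cont yki yb.
  have : nbhs (chart k y) (box l1 r1 `&` box l2 r2).
    by apply: filterI; apply/(nbhs_box ne); [exists l1, r1|exists l2, r2].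
  move=> /(nbhs_box ne)[l' [r' [yb' sb]]]; exists l', r'; split=> // w Uw /sb[w1 w2].
  have [v wv] := H1 w Uw w1; have vb := H2 _ _ wv w2.
  have /trgP[z [zk zi zw zv]] := wv.
  by exists z => //; split=> //; split=> //; rewrite zv.
by move=> x' [x'i x'b]; exact: sU.
Qed.

End space_facts.
Arguments trg {L M X} i j.

Section fun_facts.
Variables (L : language) (M : structure L) (X Y : dspace M) (f : X -> Y).

Lemma fun_graphP i j u v : fun_graph f i j (row_mx u v) <->
  exists x, [/\ chdom i x, chdom j (f x), chart i x = u & chart j (f x) = v].
Proof.
split=> [[x [xi xj] /eq_row_mx[]]|[x [xi xj <- <-]]]; first by exists x.
by exists x.
Qed.

Lemma fun_graph_total i u : (chart i @` chdom i) u ->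
  exists j v, fun_graph f i j (row_mx u v).
Proof.
case=> x xi <-; have [j fxj] := dcover (f x).
by exists j, (chart j (f x)); apply/fun_graphP; exists x.
Qed.

Lemma fun_graph_move i i' j j' u u' v v' : fun_graph f i j (row_mx u v) ->
  trg i i' (row_mx u u') -> trg j j' (row_mx v v') ->
  fun_graph f i' j' (row_mx u' v').
Proof.
move=> /fun_graphP[x [xi xj <- <-]] /trgP[y [yi yi' E1 <-]].
move=> /trgP[z [zj zj' E2 <-]]; apply/fun_graphP; exists y.
by rewrite (dinj yi xi E1) in yi' *; rewrite (dinj zj xj E2) in zj' *.
Qed.

Lemma fun_graph_uniq i j j' u v v' : fun_graph f i j (row_mx u v) ->
  fun_graph f i j' (row_mx u v') -> trg j j' (row_mx v v').
Proof.
move=> /fun_graphP[x [xi xj <- <-]] /fun_graphP[y [yi yj E <-]].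
rewrite (dinj yi xi E) in yj *.
by apply/trgP; exists (f x).
Qed.

Hypothesis ne : no_ends M.

Lemma continuous_chartP : continuous f <->
  forall i j u v, fun_graph f i j (row_mx u v) -> forall l r, box l r v ->
  exists l' r', box l' r' u /\
  forall u', (chart i @` chdom i) u' -> box l' r' u' ->
    exists v', fun_graph f i j (row_mx u' v') /\ box l r v'.
Proof.
split=> [fc i j u v /fun_graphP[x [xi xj <- <-]] l r fxb|H x U].
  have /fc : nbhs (f x) [set y | chdom j y /\ box l r (chart j y)].
    apply/(nbhs_chart ne _ xj).
    by exists l, r.
  move=> /(nbhs_chart ne _ xi)[l' [r' [xb sub]]].
  exists l', r'; split=> // _ [x' x'i <-] /(sub _ x'i)[x'j b'].
  by exists (chart j (f x')); split=> //; apply/fun_graphP; exists x'.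
have [i xi] := dcover x; have [j xj] := dcover (f x).
move=> /(nbhs_chart ne _ xj)[l [r [fxb sU]]].
apply/(nbhs_chart ne _ xi).
have /H/(_ _ _ fxb)[l' [r' [xb sub]]] :
    fun_graph f i j (row_mx (chart i x) (chart j (f x))).
  by apply/fun_graphP; exists x.
exists l', r'; split=> // x' x'i x'b.
have [|v' [/fun_graphP[y [yi yj E <-]] b']] := sub (chart i x') _ x'b.
  by exists x'.
by rewrite (dinj yi x'i E) in yj b'; exact: sU.
Qed.

End fun_facts.

Section extension.
Variables (L : language) (M S : structure L) (j : M -> S).
Hypotheses (jel : elementary j) (dM : dlo M).

Let neM : no_ends M := dlo_no_ends dM.

Ltac selt := repeat first [ exact: selp_id | apply: selp_row
                          | apply: selp_lsub | apply: selp_rsub ].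

Lemma ext_no_ends : no_ends S.
Proof.
suff H : tr j (fun _ : 'rV_0 => no_ends M) (fun _ : 'rV_0 => no_ends S).
  by apply/(tr_sent jel H).
apply: tr_all; apply: tr_ex; apply: tr_ex; apply: tr_box; selt.
Qed.

Let neS := ext_no_ends.

Section ext_facts.
Variable X : dspace M.

Local Notation img i := (@chart _ _ X i @` chdom i).
Local Notation G i k u v := (ext j (@trg L M X i k) (row_mx u v)).
Local Notation U i := (ext j (img i)).

Let trG i k : tr j (@trg L M X i k) (ext j (@trg L M X i k)) :=
  tr_def jel (trg_definable i k).
Let trU i : tr j (img i) (U i) := tr_def jel (ddef i).

Lemma ext_diag i u v : G i i u v <-> U i u /\ u = v.
Proof.
suff H : tr j (fun _ : 'rV_0 => forall u v,
      (@trg L M X i i (row_mx u v) -> img i u /\ u = v) /\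
      (img i u /\ u = v -> @trg L M X i i (row_mx u v)))
    (fun _ : 'rV_0 => forall u v,
      (G i i u v -> U i u /\ u = v) /\ (U i u /\ u = v -> G i i u v)).
  by have [HH _] := tr_sent jel H; apply: HH => u' v'; apply/trg_diag.
apply: tr_all; apply: tr_all; apply: tr_and; apply: tr_imp;
  try (apply: tr_and); try (by apply: tr_eq; selt);
  by [apply: tr_comp (trG _ _); selt | apply: tr_comp (trU _); selt].
Qed.

Lemma ext_sym i k u v : G i k u v -> G k i v u.
Proof.
suff H : tr j (fun _ : 'rV_0 => forall u v,
      @trg L M X i k (row_mx u v) -> @trg L M X k i (row_mx v u))
    (fun _ : 'rV_0 => forall u v, G i k u v -> G k i v u).
  by have [HH _] := tr_sent jel H; apply: HH => u' v'; exact: trg_sym.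
by apply: tr_all; apply: tr_all; apply: tr_imp; apply: tr_comp (trG _ _); selt.
Qed.

Lemma ext_trans i k m u v w : G i k u v -> G k m v w -> G i m u w.
Proof.
suff H : tr j (fun _ : 'rV_0 => forall u v w, @trg L M X i k (row_mx u v) ->
      @trg L M X k m (row_mx v w) -> @trg L M X i m (row_mx u w))
    (fun _ : 'rV_0 => forall u v w, G i k u v -> G k m v w -> G i m u w).
  by have [HH _] := tr_sent jel H; apply: HH => u' v' w'; exact: trg_trans.
apply: tr_all; apply: tr_all; apply: tr_all.
by apply: tr_imp; last apply: tr_imp; apply: tr_comp (trG _ _); selt.
Qed.

Lemma ext_refl i u : U i u -> G i i u u.
Proof. by move=> Uu; apply/ext_diag. Qed.

Lemma ext_dom i k u v : G i k u v -> U i u.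
Proof. by move=> uv; have /ext_diag[] := ext_trans uv (ext_sym uv). Qed.

Lemma ext_fun i k u v v' : G i k u v -> G i k u v' -> v = v'.
Proof. by move=> uv uv'; have /ext_diag[] := ext_trans (ext_sym uv) uv'. Qed.

Lemma ext_ov i k u : ext j (chart i @` (chdom i `&` chdom k)) u <->
  exists v, G i k u v.
Proof.
suff -> : ext j (chart i @` (chdom i `&` chdom k)) = fun u => exists v, G i k u v.
  by [].
apply: (tr_extE jel).
have : tr j (fun u => exists v, @trg L M X i k (row_mx u v))
   (fun u => exists v, G i k u v).
  by apply: tr_ex; apply: tr_comp (trG _ _); selt.
by apply: tr_ext => w //; rewrite trg_ov.
Qed.

Lemma ext_open i k u v : G i k u v -> exists l r, box l r u /\
  forall u', U i u' -> box l r u' -> exists v', G i k u' v'.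
Proof.
suff H : tr j (fun _ : 'rV_0 => forall u v, @trg L M X i k (row_mx u v) ->
      exists l r, box l r u /\ forall u', img i u' -> box l r u' ->
      exists v', @trg L M X i k (row_mx u' v'))
    (fun _ : 'rV_0 => forall u v, G i k u v ->
      exists l r, box l r u /\ forall u', U i u' -> box l r u' ->
      exists v', G i k u' v').
  by have [HH _] := tr_sent jel H; apply: HH => u' v'; exact: trg_open.
apply: tr_all; apply: tr_all; apply: tr_imp.
  by apply: tr_comp (trG _ _); selt.
apply: tr_ex; apply: tr_ex; apply: tr_and; first by apply: tr_box; selt.
apply: tr_all; apply: tr_imp; first by apply: tr_comp (trU _); selt.
apply: tr_imp; first by apply: tr_box; selt.
by apply: tr_ex; apply: tr_comp (trG _ _); selt.
Qed.

Lemma ext_cont i k u v : G i k u v -> forall l r, box l r v ->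
  exists l' r', box l' r' u /\
  forall u' v', G i k u' v' -> box l' r' u' -> box l r v'.
Proof.
suff H : tr j (fun _ : 'rV_0 => forall u v, @trg L M X i k (row_mx u v) ->
      forall l r, box l r v -> exists l' r', box l' r' u /\
      forall u' v', @trg L M X i k (row_mx u' v') -> box l' r' u' -> box l r v')
    (fun _ : 'rV_0 => forall u v, G i k u v ->
      forall l r, box l r v -> exists l' r', box l' r' u /\
      forall u' v', G i k u' v' -> box l' r' u' -> box l r v').
  by have [HH _] := tr_sent jel H; apply: HH => u' v'; exact: trg_cont.
apply: tr_all; apply: tr_all; apply: tr_imp.
  by apply: tr_comp (trG _ _); selt.
apply: tr_all; apply: tr_all; apply: tr_imp; first by apply: tr_box; selt.
apply: tr_ex; apply: tr_ex; apply: tr_and; first by apply: tr_box; selt.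
apply: tr_all; apply: tr_all; apply: tr_imp.
  by apply: tr_comp (trG _ _); selt.
by apply: tr_imp; apply: tr_box; selt.
Qed.

(* The points of X(S) are the classes of the disjoint union of the U_i(S),
   where U_i is the image of chart i, modulo the relations G_ik(S), where G_ik
   is the graph of the transition map from chart i to chart k. *)
Definition ext_class (i : 'I_(nchart X)) (u : 'rV[S]_(cdim i)) :
    set {k : 'I_(nchart X) & 'rV[S]_(cdim k)} :=
  [set p | ext j (trg i (tag p)) (row_mx u (tagged p))].

Definition ext_car : Type :=
  {C : set {k : 'I_(nchart X) & 'rV[S]_(cdim k)} |
    exists i u, ext j (chart i @` chdom i) u /\ C = ext_class u}.

Definition ext_chdom (i : 'I_(nchart X)) : set ext_car :=
  [set C | exists u : 'rV[S]_(cdim i), sval C (Tagged _ u)].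

Definition ext_chart (i : 'I_(nchart X)) (C : ext_car) : 'rV[S]_(cdim i) :=
  xget (const_mx (inhabited_witness (universe_neq0 S)))
    [set u | sval C (Tagged _ u)].

Lemma ext_carP (C : ext_car) i u : sval C (Tagged _ u) ->
  U i u /\ forall k v, sval C (Tagged _ v) <-> G i k u v.
Proof.
case: C => C /= [i0 [u0 [Uu0 ->]]] iu; split; first exact: ext_dom (ext_sym iu).
move=> k v; split=> /= h; first exact: ext_trans (ext_sym iu) h.
exact: ext_trans iu h.
Qed.

Lemma ext_car_eq (C D : ext_car) i (u : 'rV[S]_(cdim i)) :
  sval C (Tagged _ u) -> sval D (Tagged _ u) -> C = D.
Proof.
move=> /ext_carP[_ hC] /ext_carP[_ hD].
suff E : sval C = sval D.
  case: C D {hC hD} E => [C hC] [D hD] /= E.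
  by subst D; congr exist; exact: Prop_irrelevance.
by apply/seteqP; split=> -[k v] => [/hC/hD|/hD/hC].
Qed.

Lemma ext_chartP i (C : ext_car) (u : 'rV[S]_(cdim i)) :
  sval C (Tagged _ u) -> ext_chart i C = u.
Proof.
move=> Cu; rewrite /ext_chart; case: xgetP => [v _ /= Cv|/(_ u)//].
by have [_ /(_ i u)[/(_ Cu)/ext_diag[_ ->]]] := ext_carP Cv.
Qed.

Lemma ext_chdomP i (C : ext_car) : ext_chdom i C <->
  sval C (Tagged _ (ext_chart i C)).
Proof. by split=> [[u /[dup] Cu /ext_chartP -> //]|]; exists (ext_chart i C). Qed.

Lemma ext_pt i u : U i u -> exists C : ext_car, sval C (Tagged _ u).
Proof.
move=> Uu.
exists (exist _ (ext_class u) (ex_intro _ i (ex_intro _ u (conj Uu erefl)))).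
exact: ext_refl.
Qed.

Lemma ext_trgP i k u v : G i k u v <-> exists C : ext_car,
  [/\ ext_chdom i C, ext_chdom k C, ext_chart i C = u & ext_chart k C = v].
Proof.
split=> [uv|[C [/ext_chdomP Ci /ext_chdomP Ck <- <-]]]; last first.
  by have [_ /(_ k (ext_chart k C))[]] := ext_carP Ci; auto.
have [C Cu] := ext_pt (ext_dom uv); exists C.
have [_ /(_ k v)[_ /(_ uv) Cv]] := ext_carP Cu.
by split; [exists u|exists v|exact: ext_chartP|exact: ext_chartP].
Qed.

Lemma ext_imgE i : ext_chart i @` ext_chdom i = U i.
Proof.
apply/seteqP; split=> [u [C /ext_chdomP Ci <-]|u /ext_pt[C Cu]].
  by have [] := ext_carP Ci.
by exists C; [exists u|exact: ext_chartP].
Qed.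

Lemma ext_ovE i k : ext_chart i @` (ext_chdom i `&` ext_chdom k) =
  ext j (chart i @` (chdom i `&` chdom k)).
Proof.
apply/seteqP; split=> u.
  move=> [C [Ci Ck] <-]; apply/ext_ov; exists (ext_chart k C).
  by apply/ext_trgP; exists C.
by move=> /ext_ov[v /ext_trgP[C [Ci Ck <- _]]]; exists C.
Qed.

Lemma ext_cover (C : ext_car) : exists i, ext_chdom i C.
Proof.
case: (svalP C) => i [u [Uu E]]; exists i; exists u; rewrite E.
exact: ext_refl.
Qed.

Lemma ext_inj i (C D : ext_car) : ext_chdom i C -> ext_chdom i D ->
  ext_chart i C = ext_chart i D -> C = D.
Proof.
move=> /ext_chdomP Ci /ext_chdomP Di E; rewrite -E in Di.
exact: ext_car_eq Ci Di.
Qed.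

Lemma ext_ddef i : definable (ext_chart i @` ext_chdom i).
Proof. by rewrite ext_imgE; apply: (ext_definable jel); exact: ddef. Qed.

Lemma ext_dopen i k :
  definable (ext_chart i @` (ext_chdom i `&` ext_chdom k)) /\
  open_in (ext_chart i @` ext_chdom i)
    (ext_chart i @` (ext_chdom i `&` ext_chdom k)).
Proof.
split; first by rewrite ext_ovE; apply: (ext_definable jel); case: (dopen i k).
rewrite ext_ovE ext_imgE; apply/(open_inP neS); split=> u.
  by move=> /ext_ov[v /ext_dom].
move=> /ext_ov[v /ext_open[l [r [ub H]]]]; exists l, r; split=> // w Uw wb.
by apply/ext_ov; exact: H.
Qed.

Lemma ext_dtrans i k :
  let A := ext_chart i @` (ext_chdom i `&` ext_chdom k) in
  exists g : 'rV[S]_(cdim i) -> 'rV[S]_(cdim k),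
    [/\ forall C, ext_chdom i C -> ext_chdom k C ->
          g (ext_chart i C) = ext_chart k C,
        definable_map A g & {within A, continuous g}].
Proof.
rewrite /= ext_ovE.
pose g u := xget (const_mx (inhabited_witness (universe_neq0 S)))
  [set v : 'rV[S]_(cdim k) | G i k u v].
have gP u v : G i k u v -> g u = v.
  by move=> uv; rewrite /g; case: xgetP => [w _ /ext_fun|/(_ v)//]; apply.
exists g; split=> [C Ci Ck||].
- by apply: gP; apply/ext_trgP; exists C.
- rewrite /definable_map; have := ext_definable jel (trg_definable i k).
  congr definable; apply/seteqP; split=> w.
    rewrite -[w]hsubmxK => uv; exists (lsubmx w); last by rewrite (gP _ _ uv).
    by apply/ext_ov; exists (rsubmx w).
  by case=> u /ext_ov[v uv] <-; rewrite (gP _ _ uv).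
- apply/(within_contP neS) => u /ext_ov[v uv] l r; rewrite (gP _ _ uv) => vb.
  have [l' [r' [ub H]]] := ext_cont uv vb; exists l', r'; split=> // u'.
  by move=> /ext_ov[v' uv'] /(H _ _ uv'); rewrite (gP _ _ uv').
Qed.

Definition ext_space : dspace S :=
  DSpace ext_cover ext_inj ext_ddef ext_dopen ext_dtrans.

End ext_facts.

Section ext_fun.
Variables (X Y : dspace M) (f : X -> Y).
Hypothesis df : definable_fun f.

Local Notation F i k u v := (ext j (fun_graph f i k) (row_mx u v)).
Local Notation GX i k u v := (ext j (@trg L M X i k) (row_mx u v)).
Local Notation GY i k u v := (ext j (@trg L M Y i k) (row_mx u v)).

Let trF i k : tr j (fun_graph f i k) (ext j (fun_graph f i k)) :=
  tr_def jel (df i k).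
Let trX i k : tr j (@trg L M X i k) (ext j (@trg L M X i k)) :=
  tr_def jel (trg_definable i k).
Let trY i k : tr j (@trg L M Y i k) (ext j (@trg L M Y i k)) :=
  tr_def jel (trg_definable i k).

Lemma ext_fun_total i u : ext j (@chart L M X i @` chdom i) u ->
  exists k v, F i k u v.
Proof.
suff H : tr j (fun _ : 'rV_0 => forall u, (@chart L M X i @` chdom i) u ->
      exists k v, fun_graph f i k (row_mx u v))
    (fun _ : 'rV_0 => forall u, ext j (@chart L M X i @` chdom i) u ->
      exists k v, F i k u v).
  by have [HH _] := tr_sent jel H; apply: HH => u'; exact: fun_graph_total.
apply: tr_all; apply: tr_imp.
  by apply: tr_comp (tr_def jel (ddef i)); selt.
by apply: tr_ord_ex => k; apply: tr_ex; apply: tr_comp (trF _ _); selt.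
Qed.

Lemma ext_fun_move i i' k k' u u' v v' : F i k u v ->
  GX i i' u u' -> GY k k' v v' -> F i' k' u' v'.
Proof.
suff H : tr j (fun _ : 'rV_0 => forall u u' v v', fun_graph f i k (row_mx u v) ->
      @trg L M X i i' (row_mx u u') -> @trg L M Y k k' (row_mx v v') ->
      fun_graph f i' k' (row_mx u' v'))
    (fun _ : 'rV_0 => forall u u' v v', F i k u v ->
      GX i i' u u' -> GY k k' v v' -> F i' k' u' v').
  have [HH _] := tr_sent jel H; apply: HH => x x' y y'; exact: fun_graph_move.
do 4!apply: tr_all.
apply: tr_imp; first by apply: tr_comp (trF _ _); selt.
apply: tr_imp; first by apply: tr_comp (trX _ _); selt.
apply: tr_imp; first by apply: tr_comp (trY _ _); selt.
by apply: tr_comp (trF _ _); selt.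
Qed.

Lemma ext_fun_uniq i k k' u v v' : F i k u v -> F i k' u v' -> GY k k' v v'.
Proof.
suff H : tr j (fun _ : 'rV_0 => forall u v v', fun_graph f i k (row_mx u v) ->
      fun_graph f i k' (row_mx u v') -> @trg L M Y k k' (row_mx v v'))
    (fun _ : 'rV_0 => forall u v v', F i k u v -> F i k' u v' ->
      GY k k' v v').
  have [HH _] := tr_sent jel H; apply: HH => x y y'; exact: fun_graph_uniq.
do 3!apply: tr_all.
apply: tr_imp; first by apply: tr_comp (trF _ _); selt.
apply: tr_imp; first by apply: tr_comp (trF _ _); selt.
by apply: tr_comp (trY _ _); selt.
Qed.

(* f(S) sends the class of u to the class of the v such that (u, v) lies in
   the interpretation in S of the graph of f read in charts. *)
Definition ext_fun_class (C : ext_car X) :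
    set {k : 'I_(nchart Y) & 'rV[S]_(cdim k)} :=
  [set q | exists i (u : 'rV[S]_(cdim i)), sval C (Tagged _ u) /\
    ext j (fun_graph f i (tag q)) (row_mx u (tagged q))].

Lemma ext_fun_class_car (C : ext_car X) : exists k (v : 'rV[S]_(cdim k)),
  ext j (chart k @` chdom k) v /\ ext_fun_class C = ext_class v.
Proof.
case: (svalP C) => i [u [Uu EC]].
have [k [v uv]] := ext_fun_total Uu.
exists k, v; split; first exact: ext_dom (ext_fun_uniq uv uv).
apply/seteqP; split=> -[k' v'].
  rewrite /ext_fun_class /ext_class /= EC => -[i' [u' [/= uu' uv']]].
  have v'v' := ext_fun_uniq uv' uv'.
  exact: ext_fun_uniq uv (ext_fun_move uv' (ext_sym uu') v'v').
rewrite /ext_fun_class /ext_class /= EC => vv'; exists i, u.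
split; first exact: ext_refl.
exact: ext_fun_move uv (ext_refl Uu) vv'.
Qed.

Definition ext_map (C : ext_space X) : ext_space Y :=
  exist _ (ext_fun_class C) (ext_fun_class_car C).

Lemma ext_map_graph (i : 'I_(nchart X)) (k : 'I_(nchart Y)) :
  @fun_graph _ _ (ext_space X) (ext_space Y) ext_map i k =
  ext j (fun_graph f i k).
Proof.
apply/seteqP; split=> w.
  case=> C [/= /ext_chdomP Ci /ext_chdomP[i' [u' [Cu' uv]]] <-].
  have [_ /(_ i (ext_chart i C))[/(_ Ci) uu' _]] := ext_carP Cu'.
  exact: ext_fun_move uv uu' (ext_fun_uniq uv uv).
rewrite -[w]hsubmxK; move: (lsubmx w) (rsubmx w) => u v uv {w}.
have : ext j (@chart L M X i @` chdom i) u.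
  suff H : tr j (fun _ : 'rV_0 => forall u v, fun_graph f i k (row_mx u v) ->
        (@chart L M X i @` chdom i) u)
      (fun _ : 'rV_0 => forall u v, F i k u v ->
        ext j (@chart L M X i @` chdom i) u).
    have [HH _] := tr_sent jel H; apply: (HH _ u v uv).
    by move=> x y /fun_graphP[z [? _ <- _]]; exists z.
  do 2!apply: tr_all; apply: tr_imp; first by apply: tr_comp (trF _ _); selt.
  by apply: tr_comp (tr_def jel (ddef i)); selt.
move=> /ext_pt[C Cu].
have fC : sval (ext_map C) (Tagged _ v) by exists i, u.
apply/fun_graphP; exists C; split.
- by exists u.
- by exists v.
- exact: ext_chartP.
- exact: ext_chartP.
Qed.

Lemma ext_map_definable : definable_fun ext_map.
Proof. by move=> i k; rewrite ext_map_graph; exact: (ext_definable jel (df i k)). Qed.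

Lemma ext_map_continuous : continuous f -> continuous ext_map.
Proof.
move=> /(continuous_chartP f neM) fc.
apply/(continuous_chartP ext_map neS).
move=> /= i k; rewrite ext_map_graph.
suff H : tr j (fun _ : 'rV_0 => forall u v, fun_graph f i k (row_mx u v) ->
      forall l r, box l r v -> exists l' r', box l' r' u /\
      forall u', (@chart L M X i @` chdom i) u' -> box l' r' u' ->
      exists v', fun_graph f i k (row_mx u' v') /\ box l r v')
    (fun _ : 'rV_0 => forall u v, F i k u v ->
      forall l r, box l r v -> exists l' r', box l' r' u /\
      forall u', ext j (@chart L M X i @` chdom i) u' -> box l' r' u' ->
      exists v', F i k u' v' /\ box l r v').
  have [HH _] := tr_sent jel H; move=> u v uv l r vb.
  have [l' [r' [ub sub]]] := HH (fc i k) u v uv l r vb.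
  exists l', r'; split=> // u' Uu'; apply: sub; rewrite -ext_imgE; exact: Uu'.
do 2!apply: tr_all; apply: tr_imp; first by apply: tr_comp (trF _ _); selt.
do 2!apply: tr_all; apply: tr_imp; first by apply: tr_box; selt.
do 2!apply: tr_ex; apply: tr_and; first by apply: tr_box; selt.
apply: tr_all; apply: tr_imp.
  by apply: tr_comp (tr_def jel (ddef i)); selt.
apply: tr_imp; first by apply: tr_box; selt.
apply: tr_ex; apply: tr_and; first by apply: tr_comp (trF _ _); selt.
by apply: tr_box; selt.
Qed.

End ext_fun.
End extension.

Arguments ext_space {L M S j} jel dM X.
Arguments ext_map {L M S j} jel dM {X Y f} df C.

(* Main.v *)
Require Import Defs.
From mathcomp Require Import all_boot all_order all_algebra.
From mathcomp Require Import all_classical topology.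

Set Implicit Arguments.
Unset Strict Implicit.
Unset Printing Implicit Defensive.

Import Order.TTheory.
Local Open Scope classical_set_scope.

(**
   The theorem reduces to a statement about single curves, and such statements
   are first-order. A curve of X(S) belongs to a definable family whose
   parameters lie in S; replace the parameters by variables. That every curve of
   the family that lies in C and satisfies Q is completable in C is then a
   sentence with parameters in M, true in M iff it is true in S, because
   continuity and limits in a definable space can be expressed in charts with
   boxes ([curve_property_transfer]). The families being arbitrary, this gives:

   - for a definable subset K of a definable space, K is definably compact iff
     K(S) is ([definably_compact_transfer]);
   - call (C) the property that a curve alpha of X is completable in X as soon
     as its image under f is completable in Y; then f has (C) iff f(S) has (C).

   From f(S) to f ([proper_descends]): if K is definably compact, then so is
   K(S), then, if f(S) is definably proper, its preimage under f(S), which is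
   (f^-1 K)(S), and hence f^-1 K.

   From f to f(S): a definably proper f has (C) ([curves_of_proper]), because
   the image of f o alpha together with its two limits is a definably compact
   set K, so that alpha, a curve in f^-1 K, is completable. By transfer f(S)
   has (C). Then f(S) is definably proper ([proper_of_curves]): a curve alpha
   in the preimage of a definably compact K has an image completable in K, so
   alpha has limits in X(S), and these are mapped into K because limits in
   Y(S) are unique; Hausdorffness is itself a first-order property
   ([hausdorff_transfer]).

   O-minimality is used, in M only, for the compactness of the curve K above
   ([completed_curve_compact]). Let beta be a curve in K = image of gamma and
   two limit points. Unless beta is constant near the end under consideration,
   the sets of parameters x with gamma(x) = beta(t) are nonempty, and by
   o-minimality they accumulate, as t tends to the end, at some point x0 of
   the line or at infinity ([accumulation]). The limit of gamma at x0 is a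
   limit of beta.
*)

(** * Formulas with parameters *)

Ltac selt := repeat first [ exact: selp_id | apply: selp_row
                          | apply: selp_lsub | apply: selp_rsub ].

Section calculus.
Variables (L : language) (M S : structure L) (j : M -> S).

Lemma tr_sat n (phi : formula L n) : tr j (@sat L M n phi) (@sat L S n phi).
Proof.
case: (universe_neq0 M) => x0.
exists 0, (ren phi (lshift 0)), (const_mx x0); split=> w; rewrite sat_ren;
  by have -> : forall (T : Type) (u : 'rV[T]_n) v, sel (lshift 0) (row_mx u v) = u
    by [move=> T u v; apply/rowP => i; rewrite mxE row_mxl].
Qed.

(** Free variables may be specialized to parameters of M. *)
Lemma tr_inst n k P Q (c : 'rV[M]_k) : @tr L M S j (n + k) P Q ->
  tr j (fun w => P (row_mx w c)) (fun w => Q (row_mx w (map_mx j c))).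
Proof.
move=> [m [phi [p [HP HQ]]]].
pose g (i : 'I_((n + k) + m)) : 'I_(n + (k + m)) := cast_ord (esym (addnA _ _ _)) i.
have Eg (T : Type) (x : 'rV[T]_n) (w : 'rV[T]_k) (a : 'rV[T]_m) :
    sel g (row_mx x (row_mx w a)) = row_mx (row_mx x w) a.
  apply/rowP => i; rewrite mxE row_mxA castmxE /=; congr (row_mx _ _ _ _).
    exact/val_inj.
  exact/val_inj.
exists (k + m), (ren phi g), (row_mx c p).
by split=> w; rewrite ?map_row_mx sat_ren Eg ?HP ?HQ.
Qed.

Lemma tr_lt1 n a a' b b' : @selp L M S 1 n a a' -> @selp L M S 1 n b b' ->
  tr j (fun w => (a w ord0 ord0 < b w ord0 ord0)%O)
       (fun w => (a' w ord0 ord0 < b' w ord0 ord0)%O).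
Proof.
move=> [f [Ha Ha']] [g [Hb Hb']].
by apply: tr_ext (tr_lt j (f ord0) (g ord0)) => w; rewrite ?Ha ?Ha' ?Hb ?Hb' !mxE.
Qed.

Lemma tr_definable n P Q : @tr L M S j n P Q -> definable P.
Proof.
move=> [m [phi [p [HP _]]]]; exists m, phi, p.
by apply/seteqP; split=> w /HP.
Qed.

End calculus.

Section definability.
Variables (L : language) (M : structure L).

Lemma map_mx_idfun n (v : 'rV[M]_n) : map_mx (@id M) v = v.
Proof. by apply/rowP => i; rewrite mxE. Qed.

(** Translation from M to M itself is used below to prove definability: the
    closure properties of [tr], read with [j = id], are those of the definable
    sets. *)
Lemma elementary_id : elementary (@id M).
Proof. by move=> n phi v; rewrite map_mx_idfun. Qed.

Lemma definable_tr n (A : set 'rV[M]_n) : definable A -> tr (@id M) A A.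
Proof.
move=> dA; apply: tr_ext (tr_def elementary_id dA) => // w.
by have := tr_pt elementary_id w (tr_def elementary_id dA); rewrite map_mx_idfun => ->.
Qed.

Lemma tr_const n (c : 'rV[M]_n) : tr (@id M) (fun w => w = c) (fun w => w = c).
Proof.
apply: tr_ext (tr_inst c (@tr_eq L M M id n (n + n) lsubmx lsubmx rsubmx rsubmx _ _))
  => [w|w||]; rewrite ?map_mx_idfun ?row_mxKl ?row_mxKr //.
  by apply: selp_lsub; selt.
by apply: selp_rsub; selt.
Qed.

(** A curve in a definable space is given by one definable set for each chart.
    Quantifying over all curves of a family needs a single tuple of parameters,
    which is the concatenation of the tuples used in the charts. *)
Lemma common_parameters k (n : 'I_k -> nat) (A : forall i, set 'rV[M]_(n i)) :
  (forall i, definable (A i)) ->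
  exists m (p : 'rV[M]_m) (phi : forall i, formula L (n i + m)),
    forall i w, A i w <-> sat (phi i) (row_mx w p).
Proof.
move=> dA.
pose F i := {m : nat & (formula L (n i + m) * 'rV[M]_m)%type}.
have HF0 : forall i, exists x : F i, forall w,
    A i w <-> sat (tagged x).1 (row_mx w (tagged x).2).
  move=> i; have [m [phi [p ->]]] := dA i.
  by exists (existT _ m (phi, p)).
pose F0 i := projT1 (cid (HF0 i)); have HF i := projT2 (cid (HF0 i)).
pose m i := tag (F0 i).
pose g i (k' : 'I_(n i + m i)) : 'I_(n i + (\sum_i m i)) :=
  match fintype.split k' with inl a => lshift _ a
  | inr b => rshift (n i) (tagnat.Rank i b) end.
pose p : 'rV[M]_(\sum_i m i) := mxrow (fun i => (tagged (F0 i)).2 : 'rV_(m i)).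
exists (\sum_i m i), p, (fun i => ren (tagged (F0 i)).1 (@g i)) => i w.
rewrite sat_ren HF -/(F0 i); suff -> :
  sel (@g i) (row_mx w p) = row_mx w (tagged (F0 i)).2 by [].
apply/rowP => h; rewrite mxE /g.
rewrite -[h in RHS]splitK; case: (fintype.split h) => i' /=; rewrite !(row_mxl, row_mxr) //.
have := mxrowK (fun i => (tagged (F0 i)).2 : 'rV_(m i)) i.
by move/rowP/(_ i'); rewrite mxE.
Qed.
End definability.

(** * Ends of intervals *)

Section ends.
Variables (L : language) (N : structure L).

(** The two ends of an interval are treated at once: [s = true] is the left
    end and [s = false] the right end, and [lt_side s x y] says that x is closer
    than y to the end of side [s]. *)
Definition lt_side (s : bool) (x y : N) : Prop :=
  if s then (x < y)%O else (y < x)%O.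

Definition inside (s : bool) (o : option N) (t : N) : Prop :=
  if o is Some a then lt_side s a t else True.

(** One filter for [right_of] ([s = true]) and [left_of] ([s = false]). With
    [o = None] it is the filter of neighbourhoods of an infinity. *)
Definition near_end (s : bool) (o : option N) : set_system N :=
  [set P | exists2 c, inside s o c &
    forall t, inside s o t -> lt_side s t c -> P t].

Lemma lt_side_trans s x y z : lt_side s x y -> lt_side s y z -> lt_side s x z.
Proof. by case: s => /= xy yz; [apply: lt_trans yz|apply: lt_trans xy]. Qed.

Lemma lt_side_total s x y : lt_side s x y \/ x = y \/ lt_side s y x.
Proof. by case: s => /=; case: (ltgtP x y); auto. Qed.

Lemma near_endS s o (P Q : set N) : P `<=` Q -> near_end s o P -> near_end s o Q.
Proof. by move=> PQ [c oc H]; exists c => // t ot tc; exact/PQ/H. Qed.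

Lemma near_endI s o (P Q : set N) :
  near_end s o P -> near_end s o Q -> near_end s o (P `&` Q).
Proof.
move=> [c oc H] [d od K]; case: (lt_side_total s c d) => [cd|dc].
  by exists c => // t ot tc; split; [exact: H|apply: K => //; exact: lt_side_trans cd].
exists d => // t ot td; split; last exact: K.
by apply: H => //; case: dc => [->//|]; exact: lt_side_trans.
Qed.

Lemma open_itvP a b t : open_itv a b t <-> inside true a t /\ inside false b t.
Proof.
rewrite /open_itv /= in_itv /=; case: a b => [a|] [b|] /=; rewrite ?andbT.
- by split=> [/andP[]|[at_ tb]]; last by apply/andP.
- by split=> [|[]].
- by split=> [|[]].
- by [].
Qed.

Lemma right_ofP a P : right_of a P <-> near_end true a P.
Proof.
split=> -[c ac H]; exists c.
- by case: a ac {H} => [a|].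
- by move=> t at_ tc; apply: H; apply/open_itvP.
- by case: a ac {H} => [a|].
- by move=> t /open_itvP[]; exact: H.
Qed.

Lemma left_ofP b P : left_of b P <-> near_end false b P.
Proof.
split=> -[c bc H]; exists c.
- by case: b bc {H} => [b|].
- by move=> t bt tc; apply: H; apply/open_itvP.
- by case: b bc {H} => [b|].
- by move=> t /open_itvP[ct bt]; exact: H.
Qed.

Lemma near_end_itv s a b : (exists t, open_itv (M := N) a b t) ->
  near_end s (if s then a else b) (open_itv a b).
Proof.
move=> [t0 /open_itvP[at0 t0b]]; exists t0; first by case: s.
case: s => /= t ot tt0; apply/open_itvP; split=> //.
  by case: b t0b => [b|] //= t0b; exact: lt_trans t0b.
by case: a at0 => [a|] //= at0; exact: lt_trans tt0.
Qed.

Hypothesis dN : dlo N.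

Lemma open_itv_neq0 a b :
  (lower_end a < upper_end b)%O <-> exists t, open_itv (M := N) a b t.
Proof.
split=> [ab|[t /open_itvP[]]]; last first.
  by case: a b => [a|] [b|] //= at_ tb; rewrite bnd_simp (lt_trans at_ tb).
have [dense unb] := dN.
case: a b ab => [a|] [b|] /=.
- rewrite bnd_simp => /dense[t atb]; exists t.
  by rewrite /open_itv /= in_itv.
- move=> _; have [y [z /andP[_ az]]] := unb a; exists z.
  by apply/open_itvP.
- move=> _; have [y [z /andP[yb _]]] := unb b; exists y.
  by apply/open_itvP.
- by move=> _; case: (universe_neq0 N) => x; exists x; apply/open_itvP.
Qed.

Lemma nbhs_box1 (t : N) (U : set N) : nbhs t U <->
  exists l r : 'rV[N]_1, box l r (const_mx t) /\
    forall t' : 'rV[N]_1, box l r t' -> U (t' ord0 ord0).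
Proof.
split=> [/(nbhs_itv (dlo_no_ends dN))[l [r [lt_ [tr_ H]]]]|[l [r [/(_ ord0)]]]].
  exists (const_mx l), (const_mx r); split=> [i|t' /(_ ord0)].
    by rewrite !mxE.
  by rewrite !mxE => -[]; exact: H.
rewrite !mxE => -[lt_ tr_] H.
apply: (@filterS _ _ _ `](l ord0 ord0 : N), (r ord0 ord0 : N)[%classic).
  move=> t'; rewrite /= in_itv /= => /andP[lt' tr'].
  have := H (const_mx t'); rewrite mxE; apply=> i.
  by rewrite [i]ord1 mxE.
apply: open_nbhs_nbhs; split; first exact: itv_open.
by rewrite /= in_itv /= lt_.
Qed.

End ends.

(** * Curves and their limits read in charts *)

Section relational_curves.
Variables (L : language) (N : structure L).
Hypothesis dN : dlo N.
Let ne : no_ends N := dlo_no_ends dN.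

Section one_space.
Variable X : dspace N.

Definition chart_rel := forall i : 'I_(nchart X), set 'rV[N]_(1 + cdim i).

Definition chart_img (C : set X) (i : 'I_(nchart X)) : set 'rV[N]_(cdim i) :=
  chart i @` (C `&` chdom i).

(** The conditions, first-order in [A], under which a family [A] of relations,
    one for each chart, is the graph of a curve in [C]. The fourth one says
    that the values given by two charts are those of the same point. *)
Definition curve_rel (C : set X) (a b : option N) (A : chart_rel) : Prop :=
  (exists t : 'rV[N]_1, open_itv a b (t ord0 ord0)) /\
  (forall i (t : 'rV[N]_1) u, A i (row_mx t u) ->
    open_itv a b (t ord0 ord0) /\ chart_img C u) /\
  (forall t : 'rV[N]_1, open_itv a b (t ord0 ord0) ->
    exists i u, A i (row_mx t u)) /\
  (forall i k (t : 'rV[N]_1) u v, A i (row_mx t u) ->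
    (A k (row_mx t v) -> trg i k (row_mx u v)) /\
    (trg i k (row_mx u v) -> A k (row_mx t v))) /\
  (forall i (t : 'rV[N]_1) u, A i (row_mx t u) -> forall l r, box l r u ->
    exists c d, box c d t /\
      forall t' : 'rV[N]_1, open_itv a b (t' ord0 ord0) -> box c d t' ->
      exists u', A i (row_mx t' u') /\ box l r u').

Definition lim_rel (s : bool) (o : option N) (A : chart_rel)
    i (u : 'rV[N]_(cdim i)) : Prop :=
  forall l r, box l r u -> exists c : 'rV[N]_1, inside s o (c ord0 ord0) /\
    forall t : 'rV[N]_1, inside s o (t ord0 ord0) ->
      lt_side s (t ord0 ord0) (c ord0 ord0) ->
      exists u', A i (row_mx t u') /\ box l r u'.

Definition completable_rel (C : set X) (a b : option N) (A : chart_rel) :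
    Prop :=
  (exists i u, chart_img (i := i) C u /\ lim_rel true a A u) /\
  (exists i u, chart_img (i := i) C u /\ lim_rel false b A u).

(** These are the sets required to be definable by [definable_curve]. *)
Definition curve_graph (a b : option N) (alpha : N -> X) : chart_rel :=
  fun i => [set row_mx (const_mx t : 'rV_1) (chart i (alpha t)) |
          t in open_itv a b `&` alpha @^-1` chdom i].

Lemma const_mx00 (t : 'rV[N]_1) : const_mx (t ord0 ord0) = t.
Proof. by apply/rowP => i; rewrite [i]ord1 mxE. Qed.

Lemma curve_graphP a b alpha i (t : 'rV[N]_1) u :
  curve_graph a b alpha (i := i) (row_mx t u) <->
  [/\ open_itv a b (t ord0 ord0), chdom i (alpha (t ord0 ord0)) &
    chart i (alpha (t ord0 ord0)) = u].
Proof.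
split=> [[t' [abt ti] /eq_row_mx[<- <-]]|[abt ti <-]].
  by rewrite mxE.
by exists (t ord0 ord0); rewrite ?const_mx00.
Qed.

Lemma chart_imgP (C : set X) i x : chdom i x ->
  chart_img (i := i) C (chart i x) <-> C x.
Proof.
move=> xi; split=> [[y [Cy yi] yx]|Cx]; first by rewrite -(dinj yi xi yx).
by exists x.
Qed.

Lemma curve_relP C a b alpha : definable_curve C a b alpha <->
  curve_rel C a b (curve_graph a b alpha) /\
  forall i, definable (curve_graph a b alpha (i := i)).
Proof.
split=> [[ne0 inC cont dfn]|[[[t0 t0ab] [inC [_ [_ cont]]]] dfn]].
  split=> //; split.
    have [t abt] := (open_itv_neq0 dN a b).1 ne0.
    by exists (const_mx t); rewrite mxE.
  split=> [i t u /curve_graphP[abt ti <-]|].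
    by split=> //; apply/chart_imgP => //; exact: inC.
  split=> [t abt|].
    have [i ti] := dcover (alpha (t ord0 ord0)).
    by exists i, (chart i (alpha (t ord0 ord0))); apply/curve_graphP.
  split=> [i k t u v /curve_graphP[abt ti <-]|i t u /curve_graphP[abt ti <-] l r ub].
    split=> [/curve_graphP[_ tk <-]|/trgP[x [xi xk /(dinj xi ti) xt <-]]].
      by apply/trgP; exists (alpha (t ord0 ord0)).
    by apply/curve_graphP; rewrite -xt.
  move/subspace_continuousP: cont => /(_ _ abt).
  have /[swap] /[apply] : nbhs (alpha (t ord0 ord0))
      [set x | chdom i x /\ box l r (chart i x)].
    by apply/(nbhs_chart ne _ ti); exists l, r.
  move=> /(nbhs_box1 dN)[c [d [tb H]]]; exists c, d; rewrite const_mx00 in tb.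
  split=> // t' abt' /H /(_ abt')[t'i t'b].
  by exists (chart i (alpha (t' ord0 ord0))); split=> //; apply/curve_graphP.
split=> //.
- by apply/(open_itv_neq0 dN); exists (t0 ord0 ord0).
- move=> t abt; have [i ti] := dcover (alpha t).
  have [] := inC i (const_mx t) (chart i (alpha t)).
    by apply/curve_graphP; rewrite mxE.
  by rewrite mxE => _ /(chart_imgP _ ti).
- apply/subspace_continuousP => t abt U.
  have [i ti] := dcover (alpha t).
  move=> /(nbhs_chart ne _ ti)[l [r [tb HU]]].
  have /cont/(_ _ _ tb)[c [d [tcd H]]] :
      curve_graph a b alpha (row_mx (const_mx t) (chart i (alpha t))).
    by apply/curve_graphP; rewrite mxE.
  apply/(nbhs_box1 dN); exists c, d; split=> // t' cdt' abt'.
  by have [u' [/curve_graphP[_ t'i <-]]] := H t' abt' cdt'; exact: HU.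
Qed.

(** By the fourth condition all charts agree on the value of the curve at a
    point, so choosing one chart there recovers the curve. *)
Lemma curve_of_rel C a b A : curve_rel C a b A ->
  exists alpha, A = curve_graph a b alpha.
Proof.
move=> [[t0 t0ab] [inC [tot [cmp _]]]].
have [i0 [u0 /inC[_ [x0 _ _]]]] := tot t0 t0ab.
have /choice[alpha Halpha] : forall t : N, exists x : X, open_itv a b t ->
    forall i u, A i (row_mx (const_mx t) u) <-> chdom i x /\ chart i x = u.
  move=> t; have [abt|] := pselect (open_itv a b t); last by exists x0.
  have [|i [u iu]] := tot (const_mx t); first by rewrite mxE.
  have [_ [x [_ xi] xu]] := inC _ _ _ iu.
  exists x => _ k v; have [H1 H2] := cmp i k _ u v iu.
  split=> [/H1/trgP[y [yi yk yu yv]]|[xk xv]].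
    by rewrite -xu in yu; rewrite -(dinj yi xi yu).
  by apply: H2; apply/trgP; exists x.
exists alpha; apply: functional_extensionality_dep => i.
apply/seteqP; split=> w; rewrite -[w]hsubmxK => iw.
  have [abt _] := inC _ _ _ iw; apply/curve_graphP.
  by have [] := (Halpha _ abt i (rsubmx w)).1; rewrite ?const_mx00.
move/curve_graphP: iw => [abt ti tu].
by have := (Halpha _ abt i (rsubmx w)).2 (conj ti tu); rewrite const_mx00.
Qed.

Lemma lim_relP a b alpha s i x : chdom i x ->
  (exists t, open_itv a b t) ->
  (forall U, nbhs x U -> near_end s (if s then a else b) (alpha @^-1` U)) <->
  lim_rel s (if s then a else b) (curve_graph a b alpha) (chart i x).
Proof.
move=> xi ab0; set o := (if s then a else b); split=> [H l r xb|H U].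
  have /H Hx : nbhs x [set x' | chdom i x' /\ box l r (chart i x')].
    by apply/(nbhs_chart ne _ xi); exists l, r.
  have near_ab : near_end s o (open_itv a b) := near_end_itv s ab0.
  have [c oc Hc] := near_endI Hx near_ab.
  exists (const_mx c); rewrite mxE; split=> // t ot tc.
  have [[ti tb] abt] := Hc _ ot tc.
  by exists (chart i (alpha (t ord0 ord0))); split=> //; apply/curve_graphP.
move=> /(nbhs_chart ne _ xi)[l [r [xb HU]]].
have [c [oc Hc]] := H _ _ xb; exists (c ord0 ord0) => // t ot tc.
have [||u' [/curve_graphP[_]]] := Hc (const_mx t); rewrite ?mxE //.
by move=> ti <- /HU; exact.
Qed.

Lemma completable_relP C a b alpha : (exists t, open_itv a b t) ->
  completable C a b alpha <-> completable_rel C a b (curve_graph a b alpha).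
Proof.
move=> ab0.
split=> [[[x Cx xl] [y Cy yl]]|[[i [u [[x [Cx xi] <-] xl]]] [k [v [[y [Cy yk] <-] yl]]]]].
  have [i xi] := dcover x; have [k yk] := dcover y; split.
    exists i, (chart i x); split; first exact/chart_imgP.
    apply/(@lim_relP a b alpha true) => // U /xl; exact: (right_ofP _ _).1.
  exists k, (chart k y); split; first exact/chart_imgP.
  apply/(@lim_relP a b alpha false) => // U /yl; exact: (left_ofP _ _).1.
split.
  exists x => // U /((lim_relP alpha true xi ab0).2 xl).
  exact: (right_ofP _ _).2.
exists y => // U /((lim_relP alpha false yk ab0).2 yl).
exact: (left_ofP _ _).2.
Qed.

End one_space.
End relational_curves.

(** * Statements on all curves *)

Section curve_property.
Variables (L : language) (N : structure L).
Hypothesis dN : dlo N.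

(** An endpoint, with its kind (finite or not) separated from its value: the
    value is quantified over in formulas, the kind is not. *)
Definition endpt (k : bool) (x : N) : option N := if k then Some x else None.

Lemma endptP (o : option N) :
  exists k (x : 'rV[N]_1), o = endpt k (x ord0 ord0).
Proof.
case: o => [x|]; first by exists true, (const_mx x); rewrite mxE.
by exists false, (const_mx (inhabited_witness (universe_neq0 N))).
Qed.

Section two_spaces.
Variables (X Y : dspace N) (f : X -> Y) (C : set X) (D : set Y) (q : Prop).

Definition comp_rel (A : chart_rel X) : chart_rel Y :=
  fun k => [set w | exists i u, A i (row_mx (lsubmx w) u) /\
    fun_graph f i k (row_mx u (rsubmx w))].

Lemma comp_relE a b alpha :
  comp_rel (curve_graph a b alpha) = curve_graph a b (f \o alpha).
Proof.
apply: functional_extensionality_dep => k; apply/seteqP; split=> w.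
  move=> [i [u [/curve_graphP[abt ti <-] /fun_graphP[x [xi fxk /(dinj xi ti) xt xw]]]]].
  by rewrite -[w]hsubmxK; apply/curve_graphP; rewrite /= -xt.
rewrite -[w]hsubmxK => /curve_graphP[abt tk tw].
have [i ti] := dcover (alpha (lsubmx w ord0 ord0)).
exists i, (chart i (alpha (lsubmx w ord0 ord0))); rewrite row_mxKl row_mxKr; split.
  exact/curve_graphP.
by apply/fun_graphP; exists (alpha (lsubmx w ord0 ord0)).
Qed.

(** With [q = False] this is definable compactness of [C]. With [q = True] and
    [C], [D] the whole spaces, it is the characterization of definably proper
    maps by curves. Both have to be transferred. *)
Definition curve_property := forall a b alpha, definable_curve C a b alpha ->
  (q -> completable D a b (f \o alpha)) -> completable C a b alpha.

Definition sat_rel m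
    (phi : forall i : 'I_(nchart X), formula L ((1 + cdim i) + m))
    (p : 'rV[N]_m) : chart_rel X := fun i => [set w | sat (phi i) (row_mx w p)].

Definition rel_property a b A := curve_rel C a b A ->
  (q -> completable_rel D a b (comp_rel A)) -> completable_rel C a b A.

(** The quantification over curves, split into one over families [phi], which
    is not first-order, and one over the members of a family, which is. *)
Lemma curve_property_rel : curve_property <->
  forall m phi ka kb (p : 'rV[N]_m) (a b : 'rV[N]_1),
    rel_property (endpt ka (a ord0 ord0)) (endpt kb (b ord0 ord0))
      (sat_rel phi p).
Proof.
split=> [H m phi ka kb p a b cA|H a b alpha /(curve_relP dN)[cA dA]].
  have [alpha E] := curve_of_rel cA; rewrite E in cA * => qD.
  have ab0 : exists t, open_itv (endpt ka (a ord0 ord0)) (endpt kb (b ord0 ord0)) t.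
    by case: cA => [[t0 ?] _]; exists (t0 ord0 ord0).
  apply/(completable_relP dN) => //; apply: H; last first.
    by move=> /qD; rewrite comp_relE => /(completable_relP dN); exact.
  apply/(curve_relP dN); split=> // i; rewrite -E.
  by exists m, (phi i), p.
have ab0 : exists t, open_itv a b t.
  by case: cA => [[t0 ?] _]; exists (t0 ord0 ord0).
have [m [p [phi E]]] := common_parameters dA.
have {}E : curve_graph a b alpha = sat_rel phi p.
  by apply: functional_extensionality_dep => i; apply/seteqP; split=> w /E.
have [ka [a' Ea]] := endptP a; have [kb [b' Eb]] := endptP b.
move=> qD; apply/(completable_relP dN) => //.
have := H m phi ka kb p a' b'; rewrite -Ea -Eb -E; apply=> //.
by rewrite comp_relE => /qD/(completable_relP dN); exact.
Qed.

End two_spaces.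

Lemma definably_compactP (X Y : dspace N) (f : X -> Y) (C : set X) (D : set Y) :
  definably_compact C <-> curve_property f C D False.
Proof.
split=> H a b alpha ca; first by move=> _; exact: H.
by apply: H => // -[].
Qed.

End curve_property.

(** * Transfer to an elementary extension *)

Section transfer.
Variables (L : language) (M S : structure L) (j : M -> S).
Hypotheses (jel : elementary j) (dM : dlo M).

Lemma dlo_transfer : dlo S.
Proof.
suff H : tr j (fun _ : 'rV_0 =>
    (forall x y : 'rV[M]_1, (x ord0 ord0 < y ord0 ord0)%O -> exists z : 'rV[M]_1,
      (x ord0 ord0 < z ord0 ord0)%O /\ (z ord0 ord0 < y ord0 ord0)%O) /\
    (forall x : 'rV[M]_1, exists y z : 'rV[M]_1,
      (y ord0 ord0 < x ord0 ord0)%O /\ (x ord0 ord0 < z ord0 ord0)%O))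
  (fun _ : 'rV_0 =>
    (forall x y : 'rV[S]_1, (x ord0 ord0 < y ord0 ord0)%O -> exists z : 'rV[S]_1,
      (x ord0 ord0 < z ord0 ord0)%O /\ (z ord0 ord0 < y ord0 ord0)%O) /\
    (forall x : 'rV[S]_1, exists y z : 'rV[S]_1,
      (y ord0 ord0 < x ord0 ord0)%O /\ (x ord0 ord0 < z ord0 ord0)%O)).
  have [HH _] := tr_sent jel H; have [dense unb] := dM; have [|dS uS] := HH.
    split=> [x y /dense[z /andP[xz zy]]|x]; first by exists (const_mx z); rewrite mxE.
    have [y [z /andP[yx xz]]] := unb (x ord0 ord0).
    by exists (const_mx y), (const_mx z); rewrite !mxE.
  split=> [x y xy|x].
    have := dS (const_mx x) (const_mx y); rewrite !mxE => /(_ xy)[z [xz zy]].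
    by exists (z ord0 ord0); rewrite xz.
  have [y [z]] := uS (const_mx x); rewrite !mxE => -[yx xz].
  by exists (y ord0 ord0), (z ord0 ord0); rewrite yx.
apply: tr_and.
  do 2!apply: tr_all; apply: tr_imp; first by apply: tr_lt1; selt.
  by apply: tr_ex; apply: tr_and; apply: tr_lt1; selt.
by apply: tr_all; do 2!apply: tr_ex; apply: tr_and; apply: tr_lt1; selt.
Qed.

Let dS := dlo_transfer.

Lemma tr_lt_side n s a a' b b' : @selp L M S 1 n a a' -> @selp L M S 1 n b b' ->
  tr j (fun w => lt_side s (a w ord0 ord0) (b w ord0 ord0))
       (fun w => lt_side s (a' w ord0 ord0) (b' w ord0 ord0)).
Proof. by case: s => Ha Hb; exact: tr_lt1. Qed.

Lemma tr_inside n s k a a' b b' :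
  @selp L M S 1 n a a' -> @selp L M S 1 n b b' ->
  tr j (fun w => inside s (endpt k (a w ord0 ord0)) (b w ord0 ord0))
       (fun w => inside s (endpt k (a' w ord0 ord0)) (b' w ord0 ord0)).
Proof. by case: k => Ha Hb; [exact: tr_lt_side|exact: tr_true]. Qed.

Lemma tr_open_itv n ka kb a a' b b' t t' :
  @selp L M S 1 n a a' -> @selp L M S 1 n b b' -> @selp L M S 1 n t t' ->
  tr j (fun w => open_itv (endpt ka (a w ord0 ord0)) (endpt kb (b w ord0 ord0))
         (t w ord0 ord0))
       (fun w => open_itv (endpt ka (a' w ord0 ord0)) (endpt kb (b' w ord0 ord0))
         (t' w ord0 ord0)).
Proof.
move=> Ha Hb Ht.
apply: tr_ext (tr_and (tr_inside true ka Ha Ht) (tr_inside false kb Hb Ht)) => w;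
  exact: iff_sym (open_itvP _ _ _).
Qed.

Local Notation XS X := (ext_space jel dM X).

Lemma tr_trg (X : dspace M) i k : tr j (@trg L M X i k) (@trg L S (XS X) i k).
Proof.
apply: tr_ext (tr_def jel (trg_definable i k)) => // w.
rewrite -[w]hsubmxK; split=> [/(ext_trgP jel)[C HC]|/trgP[C HC]].
  by apply/trgP; exists C.
by apply/(ext_trgP jel); exists C.
Qed.

Lemma tr_fun_graph (X Y : dspace M) (f : X -> Y) (fd : definable_fun f) i k :
  tr j (fun_graph f i k) (@fun_graph L S (XS X) (XS Y) (ext_map jel dM fd) i k).
Proof. by rewrite ext_map_graph; exact: (tr_def jel (fd i k)). Qed.

(** [C'] is C(S). *)
Definition tr_sub (X : dspace M) (C : set X) (C' : set (XS X)) :=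
  forall i : 'I_(nchart X),
    tr j (@chart_img L M X C i) (@chart_img L S (XS X) C' i).

Lemma tr_subT (X : dspace M) : @tr_sub X setT setT.
Proof.
move=> i; rewrite /chart_img !setTI; have := tr_def jel (ddef i).
by rewrite -(ext_imgE jel).
Qed.

Lemma selp_comp k m n a a' b b' :
  @selp L M S k m a a' -> @selp L M S m n b b' ->
  selp (fun w => a (b w)) (fun w => a' (b' w)).
Proof.
move=> [f [Ha Ha']] [g [Hb Hb']]; exists (g \o f).
by split=> w; apply/rowP => i; rewrite ?Ha ?Ha' ?Hb ?Hb' !mxE.
Qed.

Section rel.
Variables (X : dspace M) (C : set X) (C' : set (XS X)).
Hypothesis trC : tr_sub C C'.
Variables (n : nat) (A : 'rV[M]_n -> chart_rel X)
  (A' : 'rV[S]_n -> chart_rel (XS X)).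

(** Families of relations, indexed by parameters [w], which have the same
    definition in M and in S. *)
Definition tr_rel (Z : dspace M) (B : 'rV[M]_n -> chart_rel Z)
    (B' : 'rV[S]_n -> chart_rel (XS Z)) :=
  forall (i : 'I_(nchart Z)) m t t' p p', @selp L M S (1 + cdim i) m t t' ->
    @selp L M S n m p p' ->
  tr j (fun w => B (p w) i (t w)) (fun w => B' (p' w) i (t' w)).

Hypothesis trA : tr_rel A A'.
Variables (a b : 'rV[M]_n -> 'rV[M]_1) (a' b' : 'rV[S]_n -> 'rV[S]_1).
Hypotheses (Ha : @selp L M S 1 n a a') (Hb : @selp L M S 1 n b b').
Variables ka kb : bool.

Ltac selc := repeat first [ exact: selp_id | apply: selp_row
  | apply: selp_lsub | apply: selp_rsub
  | apply: (selp_comp Ha) | apply: (selp_comp Hb)].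

Lemma tr_curve_rel :
  tr j (fun w => curve_rel C (endpt ka (a w ord0 ord0)) (endpt kb (b w ord0 ord0))
         (A w))
       (fun w => curve_rel C' (endpt ka (a' w ord0 ord0)) (endpt kb (b' w ord0 ord0))
         (A' w)).
Proof.
rewrite /curve_rel.
apply: tr_and; first by apply: tr_ex; apply: tr_open_itv; selc.
apply: tr_and.
  apply: tr_ord_all => i; do 2!apply: tr_all; apply: tr_imp; first by apply: trA; selc.
  by apply: tr_and; [apply: tr_open_itv; selc|apply: tr_comp (trC _); selc].
apply: tr_and.
  apply: tr_all; apply: tr_imp; first by apply: tr_open_itv; selc.
  by apply: tr_ord_ex => i; apply: tr_ex; apply: trA; selc.
apply: tr_and.
  apply: tr_ord_all => i; apply: tr_ord_all => k; do 3!apply: tr_all.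
  apply: tr_imp; first by apply: trA; selc.
  by apply: tr_and; apply: tr_imp;
    [apply: trA; selc|apply: tr_comp (tr_trg _ _); selc
    |apply: tr_comp (tr_trg _ _); selc|apply: trA; selc].
apply: tr_ord_all => i; do 2!apply: tr_all; apply: tr_imp; first by apply: trA; selc.
do 2!apply: tr_all; apply: tr_imp; first by apply: tr_box; selc.
do 2!apply: tr_ex; apply: tr_and; first by apply: tr_box; selc.
apply: tr_all; apply: tr_imp; first by apply: tr_open_itv; selc.
apply: tr_imp; first by apply: tr_box; selc.
by apply: tr_ex; apply: tr_and; [apply: trA; selc|apply: tr_box; selc].
Qed.

Lemma tr_lim_rel s k c c' (i : 'I_(nchart X)) :
  @selp L M S 1 n c c' ->
  tr j (fun w : 'rV_(cdim i + n) =>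
         lim_rel s (endpt k (c (rsubmx w) ord0 ord0)) (A (rsubmx w)) (lsubmx w))
       (fun w : 'rV_(cdim i + n) =>
         lim_rel (X := XS X) s (endpt k (c' (rsubmx w) ord0 ord0))
         (A' (rsubmx w)) (lsubmx w)).
Proof.
move=> Hc; rewrite /lim_rel.
do 2!apply: tr_all; apply: tr_imp; first by apply: tr_box; selc.
apply: tr_ex; apply: tr_and; first by apply: tr_inside; try apply: (selp_comp Hc); selc.
apply: tr_all; apply: tr_imp; first by apply: tr_inside; try apply: (selp_comp Hc); selc.
apply: tr_imp; first by apply: tr_lt_side; selc.
by apply: tr_ex; apply: tr_and; [apply: trA; selc|apply: tr_box; selc].
Qed.

Lemma tr_completable_rel :
  tr j (fun w => completable_rel C (endpt ka (a w ord0 ord0)) (endpt kb (b w ord0 ord0))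
         (A w))
       (fun w => completable_rel C' (endpt ka (a' w ord0 ord0)) (endpt kb (b' w ord0 ord0))
         (A' w)).
Proof.
by apply: tr_and; apply: tr_ord_ex => i; apply: tr_ex; apply: tr_and;
  [apply: tr_comp (trC _); selc|exact: tr_lim_rel
  |apply: tr_comp (trC _); selc|exact: tr_lim_rel].
Qed.

Lemma tr_comp_rel (Y : dspace M) (f : X -> Y) (fd : definable_fun f) :
  tr_rel (fun w => comp_rel f (A w)) (fun w => comp_rel (ext_map jel dM fd) (A' w)).
Proof.
move=> k m t t' p p' Ht Hp; rewrite /comp_rel /mkset.
apply: tr_ord_ex => i; apply: tr_ex; apply: tr_and.
  by apply: trA; [selc; apply: (selp_comp Ht); selc|apply: (selp_comp Hp); selc].
by apply: tr_comp (tr_fun_graph _ _ _); selc; apply: (selp_comp Ht); selc.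
Qed.

End rel.

Section map.
Variables (X Y : dspace M) (f : X -> Y) (fd : definable_fun f).
Variables (C : set X) (C' : set (XS X)) (D : set Y) (D' : set (XS Y)).
Hypotheses (trC : tr_sub C C') (trD : tr_sub D D').

(** For a fixed family and fixed kinds of endpoints, the property is a sentence;
    it holds in M iff it holds in S. *)
Lemma curve_property_transfer q :
  curve_property f C D q <-> curve_property (ext_map jel dM fd) C' D' q.
Proof.
suff H m (phi : forall i : 'I_(nchart X), formula L ((1 + cdim i) + m)) ka kb :
    (forall (p : 'rV[M]_m) (a b : 'rV[M]_1), rel_property f C D q
      (endpt ka (a ord0 ord0)) (endpt kb (b ord0 ord0)) (sat_rel phi p)) <->
    (forall (p : 'rV[S]_m) (a b : 'rV[S]_1),
      rel_property (ext_map jel dM fd) C' D' q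
      (endpt ka (a ord0 ord0)) (endpt kb (b ord0 ord0)) (sat_rel (X := XS X) phi p)).
  by split=> [/(curve_property_rel dM)|/(curve_property_rel dS)] HH;
    [apply/(curve_property_rel dS)|apply/(curve_property_rel dM)] => m phi ka kb;
    apply/H => p a b; exact: HH.
apply: (tr_sent jel); do 3!apply: tr_all.
have trA n (p : 'rV[M]_n -> 'rV[M]_m) p' : selp p p' ->
    tr_rel (fun w => sat_rel phi (p w)) (fun w => sat_rel (X := XS X) phi (p' w)).
  move=> Hp i k t t' c c' Ht Hc.
  by apply: tr_comp (tr_sat j (phi i)); apply: selp_row => //; exact: selp_comp Hp Hc.
apply: tr_imp; first by apply: tr_curve_rel; try apply: trA; selt.
apply: tr_imp; last by apply: tr_completable_rel; try apply: trA; selt.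
(* The hypothesis on f o alpha is present or absent according to q, which
   does not depend on the structure. *)
have [Q|nQ] := pselect q.
  apply: tr_imp; first by apply: tr_ext (tr_true j _).
  by apply: tr_completable_rel; try (apply: tr_comp_rel; apply: trA); selt.
by apply: tr_ext (tr_true j _).
Qed.

Lemma definably_compact_transfer : definably_compact C <-> definably_compact C'.
Proof.
apply: iff_trans (definably_compactP f C D) _.
apply: iff_trans (curve_property_transfer False) _.
exact: iff_sym (definably_compactP _ _ _).
Qed.

End map.

Lemma tr_ext_definable n P Q : @tr L M S j n P Q -> definable Q.
Proof.
move=> [m [phi [p [_ HQ]]]]; exists m, phi, (map_mx j p).
by apply/seteqP; split=> w /HQ.
Qed.

(** K(S) is glued from the interpretations in S of the images of K in the
    charts; they are compatible with the transition maps because this is so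
    in M. *)
Lemma exists_ext_sub (Y : dspace M) (K : set Y) : definable_sub K ->
  exists2 K' : set (XS Y), definable_sub K' & tr_sub K K'.
Proof.
move=> dK.
have mov i k u v : ext j (chart_img K (i := i)) u ->
    ext j (@trg L M Y i k) (row_mx u v) -> ext j (chart_img K (i := k)) v.
  suff H : tr j (fun _ : 'rV_0 => forall u v, chart_img K (i := i) u ->
        @trg L M Y i k (row_mx u v) -> chart_img K (i := k) v)
      (fun _ : 'rV_0 => forall u v, ext j (chart_img K (i := i)) u ->
        ext j (@trg L M Y i k) (row_mx u v) -> ext j (chart_img K (i := k)) v).
    have [HH _] := tr_sent jel H; apply: HH => {u v} u v [y [Ky yi] <-].
    by move=> /trgP[z [zi zk /(dinj zi yi) zy <-]]; exists z; rewrite // zy in zk *.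
  do 2!apply: tr_all; apply: tr_imp; first by apply: tr_comp (tr_def jel (dK i)); selt.
  apply: tr_imp; first by apply: tr_comp (tr_def jel (trg_definable i k)); selt.
  by apply: tr_comp (tr_def jel (dK k)); selt.
pose K' : set (XS Y) := [set y | exists i, ext_chdom i y /\
  ext j (chart_img K (i := i)) (ext_chart i y)].
have E (i : 'I_(nchart Y)) :
    chart_img (X := XS Y) K' (i := i) = ext j (chart_img K (i := i)).
  apply/seteqP; split=> [u [y [[k [yk Ky]] yi] <-]|u Ku].
    by apply: mov Ky _; apply/(ext_trgP jel); exists y.
  have : ext j (@chart L M Y i @` chdom i) u.
    suff H : tr j (fun _ : 'rV_0 => forall u, chart_img K (i := i) u ->
          (@chart L M Y i @` chdom i) u)
        (fun _ : 'rV_0 => forall u, ext j (chart_img K (i := i)) u ->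
          ext j (@chart L M Y i @` chdom i) u).
      by have [HH _] := tr_sent jel H; apply: HH => // v [y [_ yi] <-]; exists y.
    apply: tr_all; apply: tr_imp; first by apply: tr_comp (tr_def jel (dK i)); selt.
    by apply: tr_comp (tr_def jel (ddef i)); selt.
  rewrite -(ext_imgE jel) => -[y yi yu]; exists y => //; split=> //.
  by exists i; rewrite yu.
have tK : tr_sub K K' by move=> i; rewrite E; exact: (tr_def jel (dK i)).
by exists K' => // i; exact: tr_ext_definable (tK i).
Qed.

End transfer.
Arguments tr_subT {L M S j} jel dM X.

(** * Descent of properness *)

Section preimage.
Variables (L : language) (N : structure L) (X Y : dspace N) (f : X -> Y).

Lemma chart_img_preimage (K : set Y) i u : chart_img (f @^-1` K) (i := i) u <->
  exists k v, fun_graph f i k (row_mx u v) /\ chart_img K (i := k) v.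
Proof.
split=> [[x [Kx xi] <-]|[k [v [/fun_graphP[x [xi xk xu <-]] /(chart_imgP _ xk) Kx]]]].
  have [k xk] := dcover (f x); exists k, (chart k (f x)); split.
    by apply/fun_graphP; exists x.
  exact/chart_imgP.
by exists x.
Qed.

Lemma definable_preimage (fd : definable_fun f) (K : set Y) :
  definable_sub K -> definable_sub (f @^-1` K).
Proof.
move=> dK i; apply: (@tr_definable L N N id _ _ (chart_img (f @^-1` K) (i := i))).
suff : tr id (fun u => exists k v, fun_graph f i k (row_mx u v) /\
  chart_img K (i := k) v) (fun u => exists k v, fun_graph f i k (row_mx u v) /\
  chart_img K (i := k) v).
  by apply: tr_ext => u; apply: iff_sym; exact: chart_img_preimage.
apply: tr_ord_ex => k; apply: tr_ex; apply: tr_and.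
  by apply: tr_comp (definable_tr (fd i k)); selt.
by apply: tr_comp (definable_tr (dK k)); selt.
Qed.

End preimage.

Section backward.
Variables (L : language) (M S : structure L) (j : M -> S).
Hypotheses (jel : elementary j) (dM : dlo M).
Variables (X Y : dspace M) (f : X -> Y) (fd : definable_fun f).

(** (f^-1 K)(S) is the preimage of K(S) under f(S): membership in the preimage
    has the same definition in M and in S, in terms of the graph of the map. *)
Lemma tr_sub_preimage K K' : tr_sub (jel := jel) (dM := dM) K K' ->
  tr_sub (jel := jel) (dM := dM) (f @^-1` K) (ext_map jel dM fd @^-1` K').
Proof.
move=> tK i.
suff : tr j (fun u => exists k v, fun_graph f i k (row_mx u v) /\
  chart_img K (i := k) v) (fun u => exists (k : 'I_(nchart Y)) v,
  fun_graph (ext_map jel dM fd) i k (row_mx u v) /\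
  chart_img K' (i := k) v).
  by apply: tr_ext => u; apply: iff_sym; exact: chart_img_preimage.
apply: tr_ord_ex => k; apply: tr_ex; apply: tr_and.
  by apply: tr_comp (tr_fun_graph _ _ fd i k); selt.
by apply: tr_comp (tK k); selt.
Qed.

Lemma proper_descends :
  definably_proper (ext_map jel dM fd) -> definably_proper f.
Proof.
move=> pS K dK cK; split; first exact: definable_preimage.
have [K' dK' tK] := exists_ext_sub jel dM dK.
have cK' : definably_compact K'.
  apply/(definably_compact_transfer (f := id) _ tK (tr_subT jel dM Y)) => //.
  exact: trg_definable.
have [_] := pS K' dK' cK'.
by move/(definably_compact_transfer fd (tr_sub_preimage tK) (tr_subT jel dM Y)).
Qed.

End backward.

(** * Properness from the completability of curves *)

Section hausdorff.
Variables (L : language) (N : structure L).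
Hypothesis dN : dlo N.
Let ne : no_ends N := dlo_no_ends dN.

Definition hausdorff_rel (Y : dspace N) : Prop :=
  forall (i k : 'I_(nchart Y)) (u : 'rV[N]_(cdim i)) (v : 'rV[N]_(cdim k)),
    chart_img setT (i := i) u -> chart_img setT (i := k) v ->
    ~ trg i k (row_mx u v) ->
    exists l r l' r', box l r u /\ box l' r' v /\
      forall u' v', box l r u' -> box l' r' v' -> ~ trg i k (row_mx u' v').

(** In a Hausdorff space two distinct points have disjoint neighbourhoods; as
    the latter may be taken to be boxes in charts, this is first-order. *)
Lemma hausdorffP (Y : dspace N) : hausdorff_space Y <-> hausdorff_rel Y.
Proof.
split=> [hY i k u v [y [_ yi] <-] [z [_ zk] <-] ntr|hY y z cyz].
  have [yz|] := pselect (cluster (nbhs y) z).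
    by case: ntr; apply/trgP; exists z; rewrite (hY _ _ yz) in yi *.
  move/existsNP=> [A /existsNP[B]].
  move=> /not_implyP[/(nbhs_chart ne _ yi)[l [r [yb HA]]]].
  move=> /not_implyP[/(nbhs_chart ne _ zk)[l' [r' [zb HB]]]] AB.
  exists l, r, l', r'; do 2!split=> //; move=> u' v' u'b v'b.
  move=> /trgP[x [xi xk xu xv]]; apply: AB; exists x; split.
    by apply: HA => //; rewrite xu.
  by apply: HB => //; rewrite xv.
have [i yi] := dcover y; have [k zk] := dcover z.
have [/trgP[x [xi xk /(dinj xi yi) <- /(dinj xk zk)]]//|ntr] :=
  pselect (trg i k (row_mx (chart i y) (chart k z))).
have [||l [r [l' [r' [yb [zb sep]]]]]] := hY i k (chart i y) (chart k z) _ _ ntr.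
- exact/(chart_imgP _ yi).
- exact/(chart_imgP _ zk).
have [||x [[xi xb] [xk xb']]] := cyz [set x | chdom i x /\ box l r (chart i x)]
    [set x | chdom k x /\ box l' r' (chart k x)].
- by apply/(nbhs_chart ne _ yi); exists l, r.
- by apply/(nbhs_chart ne _ zk); exists l', r'.
by case: (sep _ _ xb xb'); apply/trgP; exists x.
Qed.

Lemma near_end_ex s (o : option N) P : near_end s o P -> exists t, P t.
Proof.
have [dense unb] := dN.
move=> [c oc H]; suff [t [ot tc]] : exists t, inside s o t /\ lt_side s t c.
  by exists t; exact: H.
case: s o oc {H} => -[a|] /= ac.
- by have [t /andP[]] := dense _ _ ac; exists t.
- by have [y [z /andP[yc _]]] := unb c; exists y.
- by have [t /andP[]] := dense _ _ ac; exists t.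
- by have [y [z /andP[_ cz]]] := unb c; exists z.
Qed.

Lemma near_end_lim_unique (Y : dspace N) s o (beta : N -> Y) (y z : Y) :
  hausdorff_space Y ->
  (forall U, nbhs y U -> near_end s o (beta @^-1` U)) ->
  (forall U, nbhs z U -> near_end s o (beta @^-1` U)) -> y = z.
Proof.
move=> hY ly lz; apply: hY => A B /ly HA /lz HB.
by have [t []] := near_end_ex (near_endI HA HB); exists (beta t).
Qed.

Section map.
Variables (X Y : dspace N) (f : X -> Y).
Hypotheses (fc : continuous f) (fd : definable_fun f).

Lemma definable_curve_comp (C : set X) (D : set Y) a b alpha :
  C `<=` f @^-1` D -> definable_curve C a b alpha ->
  definable_curve D a b (f \o alpha).
Proof.
move=> CD ca; have [_ dA] := (curve_relP dN C a b alpha).1 ca.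
case: ca => ab0 inC cont _; split=> //.
- by move=> t abt; apply: CD; exact: inC.
- apply/subspace_continuousP => t abt; move/subspace_continuousP: cont => /(_ t abt).
  by move=> ct; apply: cvg_comp ct _; exact: fc.
move=> k; have := comp_relE f a b alpha => /(congr1 (fun A : chart_rel Y => A k)) /= E.
suff : definable (curve_graph a b (f \o alpha) (i := k)) by [].
rewrite -E; apply: (@tr_definable L N N id _ _ (comp_rel f (curve_graph a b alpha) (i := k))).
rewrite /comp_rel; apply: tr_ord_ex => i; apply: tr_ex; apply: tr_and.
  by apply: tr_comp (definable_tr (dA i)); selt.
by apply: tr_comp (definable_tr (fd i k)); selt.
Qed.

(** A curve in f^-1 K has an image that is completable in K, and is therefore
    completable in X. Its limits lie in f^-1 K since f maps them to the limits
    in K, by uniqueness of limits in Y. *)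
Lemma proper_of_curves : hausdorff_space Y ->
  curve_property f setT setT True -> definably_proper f.
Proof.
move=> hY H K dK cK; split; first exact: definable_preimage.
move=> a b alpha ca.
have [[y Ky yl] [z Kz zl]] := cK _ _ _ (definable_curve_comp (@subset_refl _ _) ca).
have [||[x _ xl] [w _ wl]] := H a b alpha.
- by case: ca => ? _ ? ?; split.
- by move=> _; split; [exists y|exists z].
split.
  exists x => //; suff E : y = f x by rewrite /= -E.
  apply: (near_end_lim_unique (s := true) (o := a) (beta := f \o alpha) hY).
    by move=> U /yl/(right_ofP _ _).
  by move=> U /fc/xl/(right_ofP _ _).
exists w => //; suff E : z = f w by rewrite /= -E.
apply: (near_end_lim_unique (s := false) (o := b) (beta := f \o alpha) hY).
  by move=> U /zl/(left_ofP _ _).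
by move=> U /fc/wl/(left_ofP _ _).
Qed.

End map.
End hausdorff.

Section hausdorff_transfer.
Variables (L : language) (M S : structure L) (j : M -> S).
Hypotheses (jel : elementary j) (dM : dlo M).

Lemma hausdorff_transfer (Y : dspace M) :
  hausdorff_space Y -> hausdorff_space (ext_space jel dM Y).
Proof.
move=> /(hausdorffP dM) hY; apply/(hausdorffP (dlo_transfer jel dM)).
suff H : tr j (fun _ : 'rV_0 => hausdorff_rel Y)
    (fun _ : 'rV_0 => hausdorff_rel (ext_space jel dM Y)).
  by have [HH _] := tr_sent jel H; exact: HH.
apply: tr_ord_all => i; apply: tr_ord_all => k; do 2!apply: tr_all.
apply: tr_imp; first by apply: tr_comp (tr_subT jel dM Y i); selt.
apply: tr_imp; first by apply: tr_comp (tr_subT jel dM Y k); selt.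
apply: tr_imp; first by apply: tr_not; apply: tr_comp (tr_trg jel dM i k); selt.
do 4!apply: tr_ex; do 2!(apply: tr_and; first by apply: tr_box; selt).
do 2!apply: tr_all; do 2!(apply: tr_imp; first by apply: tr_box; selt).
by apply: tr_not; apply: tr_comp (tr_trg jel dM i k); selt.
Qed.
End hausdorff_transfer.

(** * Consequences of o-minimality *)

Section o_minimality.
Variables (L : language) (N : structure L).
Hypothesis oN : o_minimal N.
Let dN : dlo N := proj1 oN.
Let ne : no_ends N := dlo_no_ends dN.

(** The germ of P at the end is constant: this holds for intervals and is
    preserved by Boolean operations, hence holds for all definable P. *)
Definition decided s (o : option N) (P : set N) :=
  near_end s o P \/ near_end s o (~` P).

Lemma decidedC s o P : decided s o P -> decided s o (~` P).
Proof. by rewrite /decided setCK; case; [right|left]. Qed.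

Lemma decidedU s o P Q : decided s o P -> decided s o Q -> decided s o (P `|` Q).
Proof.
move=> [HP|HP]; first by left; apply: near_endS HP => t; left.
move=> [HQ|HQ]; first by left; apply: near_endS HQ => t; right.
by right; rewrite setCU; exact: near_endI.
Qed.

Lemma decidedI s o P Q : decided s o P -> decided s o Q -> decided s o (P `&` Q).
Proof.
move=> HP HQ; rewrite -[P `&` Q]setCK setCI.
by apply/decidedC/decidedU; exact: decidedC.
Qed.

Lemma lt_side_irr s (x : N) : ~ lt_side s x x.
Proof. by case: s; rewrite /lt_side ltxx. Qed.

Lemma near_endT s (o : option N) : near_end s o setT.
Proof.
have [_ unb] := dN; suff [c oc] : exists c, inside s o c by exists c.
case: o => [a|]; last by exists (inhabited_witness (universe_neq0 N)).
by have [y [z /andP[ya az]]] := unb a; case: s; [exists z|exists y].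
Qed.

Lemma lt_not_inside s (o : option N) e t :
  ~ inside s o e -> inside s o t -> lt_side s e t.
Proof.
case: o => [a|] //= ae at_; case: (lt_side_total s a e) => [//|[<- //|ea]].
exact: lt_side_trans at_.
Qed.

Lemma decided_before s o e : decided s o [set t | lt_side s t e].
Proof.
have [oe|oe] := pselect (inside s o e); first by left; exists e.
right; have [c oc _] := near_endT s o; exists c => // t ot _ te.
exact: lt_side_irr (lt_side_trans te (lt_not_inside oe ot)).
Qed.

Lemma decided_after s o e : decided s o [set t | lt_side s e t].
Proof.
have [oe|oe] := pselect (inside s o e).
  by right; exists e => // t _ te et; exact: lt_side_irr (lt_side_trans te et).
left; have [c oc _] := near_endT s o; exists c => // t ot _; exact: (lt_not_inside oe ot).
Qed.

Lemma decided_lt s o e : decided s o [set t | (t < e)%O].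
Proof. by case: s; [exact: decided_before|exact: decided_after]. Qed.

Lemma decided_gt s o e : decided s o [set t | (e < t)%O].
Proof. by case: s; [exact: decided_after|exact: decided_before]. Qed.

Lemma decided_cst s o (p : Prop) : decided s o [set _ | p].
Proof.
by have [hp|hp] := pselect p; [left|right]; apply: near_endS (near_endT s o).
Qed.

Lemma decided_itv s o (I : interval N) : decided s o [set t | t \in I].
Proof.
case: I => l r.
have -> : [set t | t \in Interval l r] =
    [set t | (l <= BLeft t)%O] `&` [set t | (BRight t <= r)%O].
  by apply/seteqP; split=> t; rewrite /= itv_boundlr => /andP.
apply: decidedI.
  case: l => [[] e|[]]; rewrite /=.
  - have -> : [set t | (BLeft e <= BLeft t)%O] = ~` [set t | (t < e)%O].
      by apply/seteqP; split=> t /=; rewrite bnd_simp leNgt => /negP.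
    exact/decidedC/decided_lt.
  - have -> : [set t | (BRight e <= BLeft t)%O] = [set t | (e < t)%O].
      by apply/seteqP; split=> t /=; rewrite bnd_simp.
    exact: decided_gt.
  - exact: (decided_cst s o true).
  - exact: (decided_cst s o false).
case: r => [[] e|[]]; rewrite /=.
- have -> : [set t | (BRight t <= BLeft e)%O] = [set t | (t < e)%O].
    by apply/seteqP; split=> t /=; rewrite bnd_simp.
  exact: decided_lt.
- have -> : [set t | (BRight t <= BRight e)%O] = ~` [set t | (e < t)%O].
    by apply/seteqP; split=> t /=; rewrite bnd_simp leNgt => /negP.
  exact/decidedC/decided_gt.
- exact: (decided_cst s o false).
- exact: (decided_cst s o true).
Qed.

Lemma definable_intervals (P : set 'rV[N]_1) : definable P ->
  exists Is : seq (interval N), forall t,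
    P (const_mx t) <-> exists2 I : interval N, I \in Is & t \in I.
Proof.
move=> /oN.2[Is E]; exists Is => t; have /seteqP[s1 s2] := E.
by split=> [/s1|H]; [|apply: s2]; rewrite /= mxE.
Qed.

Lemma definable_decided s o (P : set 'rV[N]_1) : definable P ->
  decided s o [set t | P (const_mx t)].
Proof.
move=> /definable_intervals[Is E].
have -> : [set t | P (const_mx t)] = [set t | exists2 I : interval N, I \in Is & t \in I].
  by apply/seteqP; split=> t /E.
elim: Is {E} => [|I Is IH].
  have -> : [set t : N | exists2 I : interval N, I \in [::] & t \in I] = [set _ | False].
    by apply/seteqP; split=> t //= [].
  exact: decided_cst.
have -> : [set t | exists2 J : interval N, J \in I :: Is & t \in J] =
    [set t | t \in I] `|` [set t | exists2 J : interval N, J \in Is & t \in J].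
  apply/seteqP; split=> t /=.
    by move=> [J]; rewrite inE => /orP[/eqP->|]; [left|right; exists J].
  case=> [tI|[J JI tJ]]; first by exists I; rewrite ?mem_head.
  by exists J; rewrite // inE JI orbT.
by apply: decidedU => //; exact: decided_itv.
Qed.

Definition is_inf (E : set N) s := (forall x, E x -> (s <= x)%O) /\
  forall x, (s < x)%O -> exists2 y, E y & (y < x)%O.

(** For a left-bounded interval the infimum is its left endpoint, which exists
    in M whether or not the order is complete. *)
Lemma itv_inf (I : interval N) m : (exists x, x \in I) ->
  (forall x, x \in I -> (m <= x)%O) -> exists s, is_inf [set x | x \in I] s.
Proof.
have [dense unb] := dN.
case: I => l r [x0 xI] mI; move: (xI); rewrite itv_boundlr => /andP[lx xr].
have sub z : (l <= BLeft z)%O -> (z <= x0)%O -> z \in Interval l r.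
  move=> lz zx; rewrite itv_boundlr lz /=; apply: le_trans xr.
  by rewrite bnd_simp.
case: l sub lx xI mI => [b e|[]] sub lx xI mI.
- exists e; split=> [x|x ex].
    rewrite /= itv_boundlr => /andP[+ _].
    by case: (b); rewrite bnd_simp // => /ltW.
  have [x0x|xx0] := ltP x0 x; first by exists x0.
  have [z /andP[ez zx]] := dense _ _ ex; exists z => //=.
  apply: sub; first by case: (b); rewrite bnd_simp // ltW.
  exact: le_trans (ltW zx) xx0.
(* An interval without left endpoint has a point below its lower bound m. *)
- have [y [z /andP[ym mz]]] := unb m.
  have : y \in Interval -oo%O r by apply: sub => //; exact: le_trans (ltW ym) (mI _ xI).
  by move/mI; rewrite leNgt ym.
- by [].
Qed.

(** By induction on the intervals that make up the set: the infimum of a union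
    is the smaller of the infima of the nonempty parts. *)
Lemma definable_inf (P : set 'rV[N]_1) m : definable P ->
  (exists x, P (const_mx x)) -> (forall x, P (const_mx x) -> (m <= x)%O) ->
  exists s, is_inf [set x | P (const_mx x)] s.
Proof.
move=> /definable_intervals[Is E] ex lb.
have -> : [set t | P (const_mx t)] = [set t | exists2 I : interval N, I \in Is & t \in I].
  by apply/seteqP; split=> t /E.
have {ex}[x /E ex] := ex; have {E}lb y :
    (exists2 I : interval N, I \in Is & y \in I) -> (m <= y)%O.
  by move=> /E/lb.
elim: Is x ex lb => [|I Is IH] x ex lb; first by case: ex.
have lbI y : y \in I -> (m <= y)%O by move=> yI; apply: lb; exists I; rewrite ?mem_head.
have lbIs y : (exists2 J : interval N, J \in Is & y \in J) -> (m <= y)%O.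
  by move=> [J JI yJ]; apply: lb; exists J; rewrite // inE JI orbT.
have HU E : E = [set t | exists2 J : interval N, J \in I :: Is & t \in J] ->
    forall y, E y <-> y \in I \/ exists2 J : interval N, J \in Is & y \in J.
  move=> -> y; split=> [[J]|].
    by rewrite inE => /orP[/eqP->|]; [left|right; exists J].
  case=> [yI|[J JI yJ]]; first by exists I; rewrite ?mem_head.
  by exists J; rewrite // inE JI orbT.
set E := (X in is_inf X); have {}HU := HU E erefl.
have [exI|nI] := pselect (exists x, x \in I); last first.
  have EE : E = [set t | exists2 J : interval N, J \in Is & t \in J].
    apply/seteqP; split=> t; last by move=> ?; apply/HU; right.
    by move=> /HU[tI|//]; case: nI; exists t.
  rewrite EE; apply: (IH x) => //.
  by move/HU: ex; case=> // xI; case: nI; exists x.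
have [s1 [i1 j1]] := itv_inf exI lbI.
have [[z Hz]|nIs] := pselect (exists z, exists2 J : interval N, J \in Is & z \in J); last first.
  exists s1; split=> [y /HU[/i1//|yI]|y /j1[z zI zy]]; first by case: nIs; exists y.
  by exists z => //; apply/HU; left.
have [s2 [i2 j2]] := IH z Hz lbIs.
have [s12|s21] := leP s1 s2.
  exists s1; split=> [y /HU[/i1//|/i2]|y /j1[t tI ty]]; first exact: le_trans.
  by exists t => //; apply/HU; left.
exists s2; split=> [y /HU[/i1|/i2//]|y /j2[t tI ty]]; first exact/le_trans/ltW.
by exists t => //; apply/HU; right.
Qed.

Lemma definable_upper (P : set 'rV[N]_1) : definable P ->
  (forall x y, (x < y)%O -> P (const_mx x) -> P (const_mx y)) ->
  [\/ forall x, P (const_mx x), forall x, ~ P (const_mx x) |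
    exists s, forall x, ((s < x)%O -> P (const_mx x)) /\
      ((x < s)%O -> ~ P (const_mx x))].
Proof.
move=> dP up.
have [|/existsNP[m Pm]] := pselect (forall x, P (const_mx x)); first by constructor 1.
have [ex|nex] := pselect (exists x, P (const_mx x)); last first.
  by constructor 2 => x Px; apply: nex; exists x.
have [x Px|s [s1 s2]] := definable_inf (m := m) dP ex.
  by rewrite leNgt; apply/negP => /up/(_ Px).
constructor 3; exists s => x; split=> [/s2[y Py yx]|xs /s1]; first exact: up Py.
by rewrite leNgt xs.
Qed.

(** Compactness of the line with its two infinities, for definable families of
    nonempty sets T_t indexed by points t tending to an end. Let E be the set
    of the x such that T_t meets the half-line below x for all t near the end.
    It is definable and upward closed, so it is a half-line with endpoint x0,
    possibly infinite. If l < x0 < r, then T_t meets the half-line below some y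
    with x0 < y < r, and avoids the one below l, when t is near the end;
    for the latter, the negation of eventually meeting is eventually avoiding,
    by o-minimality. *)
Lemma accumulation s o (T : set 'rV[N]_(1 + 1)) : definable T ->
  near_end s o [set t | exists x, T (row_mx (const_mx t) (const_mx x))] ->
  exists F : set_system N,
    [\/ exists x : N, F = nbhs x, F = near_end true None | F = near_end false None] /\
    forall W, F W ->
      near_end s o [set t | exists2 x, T (row_mx (const_mx t) (const_mx x)) & W x].
Proof.
move=> dT exT; have [dense unb] := dN.
pose R : set 'rV[N]_(1 + 1) := [set w | exists x : 'rV[N]_1, T (row_mx (lsubmx w) x) /\
  ~ (rsubmx w ord0 ord0 < x ord0 ord0)%O].
have trR : tr (@id N) R R.
  apply: tr_ex; apply: tr_and; first by apply: tr_comp (definable_tr dT); selt.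
  by apply: tr_not; apply: tr_lt1; selt.
have RP t x : R (row_mx (const_mx t) (const_mx x)) <->
    exists2 y, T (row_mx (const_mx t) (const_mx y)) & (y <= x)%O.
  rewrite /R /= row_mxKl row_mxKr mxE; split=> [[y [Ty /negP]]|[y Ty]].
    by rewrite -leNgt => yx; exists (y ord0 ord0); rewrite ?const_mx00.
  by rewrite leNgt => /negP yx; exists (const_mx y); rewrite mxE.
pose E : set 'rV[N]_1 := [set x | near_end s o [set t | R (row_mx (const_mx t) x)]].
have dE : definable E.
  (* The end is a parameter of the definition of E: in E2 it is a variable. *)
  have [k [e Eo]] := endptP o.
  pose E2 : set 'rV[N]_(1 + 1) := [set w | exists c : 'rV[N]_1,
    inside s (endpt k (rsubmx w ord0 ord0)) (c ord0 ord0) /\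
    forall t : 'rV[N]_1, inside s (endpt k (rsubmx w ord0 ord0)) (t ord0 ord0) ->
      lt_side s (t ord0 ord0) (c ord0 ord0) -> R (row_mx t (lsubmx w))].
  have trE2 : tr (@id N) E2 E2.
    apply: tr_ex; apply: tr_and; first by apply: tr_inside; selt.
    apply: tr_all; apply: tr_imp; first by apply: tr_inside; selt.
    by apply: tr_imp; [apply: tr_lt_side; selt|apply: tr_comp trR; selt].
  apply: tr_definable (tr_ext _ _ (tr_inst e trE2)) => [x|x]; last exact: iff_refl.
  rewrite /E2 /E /= row_mxKl row_mxKr -Eo; split=> -[c].
    by move=> [oc H]; exists (c ord0 ord0) => // t ot tc; apply: H; rewrite mxE.
  move=> oc H; exists (const_mx c); rewrite mxE; split=> // t ot tc.
  by rewrite -(const_mx00 t); exact: H.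
have below x : ~ E (const_mx x) -> near_end s o [set t | forall y,
    T (row_mx (const_mx t) (const_mx y)) -> (x < y)%O].
  move=> nE; case: (@definable_decided s o [set t | R (row_mx t (const_mx x))]) => [|//|].
    exact: tr_definable (tr_inst (const_mx x) trR).
  apply: near_endS => t nR y Ty.
  by rewrite ltNge; apply/negP => yx; apply: nR; apply/RP; exists y.
have above x : E (const_mx x) ->
    near_end s o [set t | exists2 y, T (row_mx (const_mx t) (const_mx y)) & (y <= x)%O].
  by apply: near_endS => t /RP.
case: (definable_upper dE) => [x y xy|Eall|Enone|[x0 Ex]].
- apply: near_endS => t /RP[z Tz zx]; apply/RP; exists z => //.
  exact: le_trans zx (ltW xy).
- exists (near_end true None); split; first by constructor 2.
  move=> W [c _ HW]; have [y [_ /andP[yc _]]] := unb c.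
  apply: near_endS (above y (Eall y)) => t [z Tz zy]; exists z => //.
  exact/HW/(le_lt_trans zy).
- exists (near_end false None); split; first by constructor 3.
  move=> W [c _ HW].
  apply: near_endS (near_endI exT (below c (Enone c))) => t [[z Tz] cz].
  by exists z => //; apply: HW => //; exact: cz.
exists (nbhs x0); split; first by constructor 1; exists x0.
move=> W /(nbhs_itv ne)[l [r [lx [xr HW]]]].
have [y /andP[xy yr]] := dense _ _ xr.
apply: near_endS (near_endI (above y ((Ex y).1 xy)) (below l ((Ex l).2 lx))).
move=> t [[z Tz zy] lz]; exists z => //.
by apply: HW; [exact: lz|exact: le_lt_trans yr].
Qed.

End o_minimality.

(** * The compact set formed by a curve and its limits *)

Section completed_curve.
Variables (L : language) (N : structure L).
Hypothesis oN : o_minimal N.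
Let dN : dlo N := proj1 oN.
Let ne : no_ends N := dlo_no_ends dN.

Lemma definable_sub1 (Y : dspace N) (y : Y) : definable_sub [set y].
Proof.
move=> i; apply: (@tr_definable L N N id _ _ (chart_img [set y] (i := i))).
have [yi|yi] := pselect (chdom i y); last first.
  by apply: tr_ext (tr_false id _) => u; split=> // -[z [-> zi]].
by apply: tr_ext (tr_const (chart i y)) => u;
  split=> [->|[z [-> _] <-]] //; exists y.
Qed.

Lemma definable_subU (Y : dspace N) (A B : set Y) :
  definable_sub A -> definable_sub B -> definable_sub (A `|` B).
Proof.
move=> dA dB i; rewrite setIUl image_setU.
exact: tr_definable (tr_or (definable_tr (dA i)) (definable_tr (dB i))).
Qed.

Section curve.
Variables (Y : dspace N) (a b : option N) (gamma : N -> Y) (ya yb : Y).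
Hypothesis cg : definable_curve setT a b gamma.
Hypothesis ya_lim : gamma @ right_of a --> ya.
Hypothesis yb_lim : gamma @ left_of b --> yb.

Definition completed_curve : set Y := gamma @` open_itv a b `|` [set ya; yb].

Lemma definable_completed_curve : definable_sub completed_curve.
Proof.
apply: definable_subU; last by apply: definable_subU; exact: definable_sub1.
have [_ dg] := (curve_relP dN _ _ _ _).1 cg.
move=> i; apply: (@tr_definable L N N id _ _ (chart_img (gamma @` open_itv a b) (i := i))).
have E v : (exists t, curve_graph a b gamma (i := i) (row_mx t v)) <->
    chart_img (gamma @` open_itv a b) v.
  split=> [[t /curve_graphP[abt ti <-]]|[y [[t abt <-] ti] <-]].
    by exists (gamma (t ord0 ord0)) => //; split=> //; exists (t ord0 ord0).
  by exists (const_mx t); apply/curve_graphP; rewrite mxE.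
apply: (tr_ext E E).
by apply: tr_ex; apply: tr_comp (definable_tr (dg i)); selt.
Qed.

(** At points x between a and b the limit is gamma(x). The points not above
    a and -oo get the limit at a, those not below b and +oo the limit at b: in these
    places only the values of gamma at points between a and b matter, and near
    the place all such points are close to the end of the interval, or there
    are none. *)
Lemma completed_curve_limit (F : set_system N) :
  [\/ exists x : N, F = nbhs x, F = near_end true None | F = near_end false None] ->
  exists2 y, completed_curve y &
    forall U, nbhs y U -> F [set t | open_itv a b t -> U (gamma t)].
Proof.
move=> HF; have [_ _ cont _] := cg.
have Hya U : nbhs ya U -> near_end true a [set t | U (gamma t)].
  by move=> /ya_lim/(right_ofP _ _).
have Hyb U : nbhs yb U -> near_end false b [set t | U (gamma t)].
  by move=> /yb_lim/(left_ofP _ _).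
have Ka : completed_curve ya by right; left.
have Kb : completed_curve yb by right; right.
case: HF => [[x ->]|->|->].
- have [abx|] := pselect (open_itv a b x).
    exists (gamma x); first by left; exists x.
    by move=> U xU; move/subspace_continuousP: cont => /(_ _ abx) /(_ U xU).
  rewrite open_itvP => /not_andP[ax|bx].
    exists ya => // U /Hya[c ac HU]; apply/(nbhs_box1 dN).
    have [l [r /(_ ord0) [lx xr]]] := ne (const_mx x).
    exists l, (const_mx c); split=> [i|t /(_ ord0)[_ tc] /open_itvP[at_ _]].
      by rewrite [i]ord1 !mxE in lx *; split=> //; exact: lt_not_inside ax ac.
    by rewrite mxE in tc; exact: HU.
  exists yb => // U /Hyb[c bc HU]; apply/(nbhs_box1 dN).
  have [l [r /(_ ord0) [lx xr]]] := ne (const_mx x).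
  exists (const_mx c), r; split=> [i|t /(_ ord0)[ct _] /open_itvP[_ tb]].
    by rewrite [i]ord1 !mxE in xr *; split=> //; exact: lt_not_inside bx bc.
  by rewrite mxE in ct; exact: HU.
- exists ya => // U /Hya[c ac HU]; exists c => // t _ tc /open_itvP[at_ _].
  exact: HU.
- exists yb => // U /Hyb[c bc HU]; exists c => // t _ tc /open_itvP[_ tb].
  exact: HU.
Qed.

(** If beta takes the value ya, or yb, arbitrarily close to the end, then by
    o-minimality it is constant near it. Otherwise beta(t) = gamma(x) for some
    x between a and b, for all t near the end, and [accumulation] applies to
    the set of these x. *)
Lemma completed_curve_end c d beta s :
  definable_curve completed_curve c d beta ->
  exists2 y, completed_curve y & forall U, nbhs y U ->
    near_end s (if s then c else d) (beta @^-1` U).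
Proof.
move=> cb; set o := (if s then c else d).
have [_ dg] := (curve_relP dN _ _ _ _).1 cg.
have [_ db] := (curve_relP dN _ _ _ _).1 cb.
have [ne0 inK _ _] := cb.
have near_cd : near_end s o (open_itv c d).
  exact: near_end_itv ((open_itv_neq0 dN c d).1 ne0).
have lim_at y : completed_curve y ->
    (exists2 y', completed_curve y' & forall U, nbhs y' U ->
      near_end s o (beta @^-1` U)) \/ near_end s o [set t | beta t <> y].
  move=> Ky; have [i yi] := dcover y.
  have := @definable_decided _ _ oN s o
    [set t | curve_graph c d beta (i := i) (row_mx t (chart i y))].
  case=> [|H|H].
  - exact: tr_definable (tr_inst (chart i y) (definable_tr (db i))).
  - left; exists y => // U yU; apply: near_endS H => t /curve_graphP[_].
    by rewrite mxE /= => ti /(dinj ti yi) ->; exact: nbhs_singleton.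
  - right; apply: near_endS (near_endI near_cd H) => t [cdt nt] ty; apply: nt.
    by apply/curve_graphP; rewrite mxE ty.
have [//|nya] := lim_at ya (or_intror (or_introl erefl)).
have [//|nyb] := lim_at yb (or_intror (or_intror erefl)).
(* The pairs (t, x) with gamma x = beta t, compared in a common chart. *)
pose T : set 'rV[N]_(1 + 1) := [set w | exists k v,
  curve_graph c d beta (i := k) (row_mx (lsubmx w) v) /\
  curve_graph a b gamma (i := k) (row_mx (rsubmx w) v)].
have dT : definable T.
  apply: (@tr_definable L N N id _ _ T).
  apply: tr_ord_ex => k; apply: tr_ex; apply: tr_and.
    by apply: tr_comp (definable_tr (db k)); selt.
  by apply: tr_comp (definable_tr (dg k)); selt.
have TP t x : T (row_mx (const_mx t) (const_mx x)) <->
    [/\ open_itv c d t, open_itv a b x & gamma x = beta t].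
  rewrite /T /= row_mxKl row_mxKr; split.
    move=> [k [v [/curve_graphP[] + + <- /curve_graphP[]]]]; rewrite !mxE.
    by move=> cdt tk abx xk /(dinj xk tk).
  move=> [cdt abx xt]; have [k tk] := dcover (beta t).
  exists k, (chart k (beta t)); split; apply/curve_graphP; rewrite mxE //.
  by rewrite xt.
have [|F [HF FT]] := accumulation oN dT (s := s) (o := o).
  apply: near_endS (near_endI near_cd (near_endI nya nyb)) => t [cdt [ta tb]].
  have [[x abx xt]|[]//] := inK _ cdt.
  by exists x; apply/TP.
have [y Ky Hy] := completed_curve_limit HF.
exists y => // U /Hy/FT; apply: near_endS => t [x /TP[_ abx xt]] /(_ abx).
by rewrite /= xt.
Qed.

Lemma completed_curve_compact : definably_compact completed_curve.
Proof.
move=> c d beta cb; split.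
  have [y Ky H] := completed_curve_end true cb; exists y => // U /H.
  exact: (right_ofP _ _).2.
have [y Ky H] := completed_curve_end false cb; exists y => // U /H.
exact: (left_ofP _ _).2.
Qed.

End curve.

(** Apply properness to the compact set formed by f o alpha and its limits. *)
Lemma curves_of_proper (X Y : dspace N) (f : X -> Y) :
  continuous f -> definable_fun f -> definably_proper f ->
  curve_property f setT setT True.
Proof.
move=> fc fd pf a b alpha ca /(_ I)[[ya _ yal] [yb _ ybl]].
have cg : definable_curve setT a b (f \o alpha).
  exact: definable_curve_comp ca.
have [_] := pf _ (definable_completed_curve ya yb cg) (completed_curve_compact cg yal ybl).
move=> /(_ a b alpha)[].
  case: ca => ab0 _ cont dfn; split=> // t abt; left; exists t => //.
by move=> [x _ xl] [y _ yl]; split; [exists x|exists y].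
Qed.

End completed_curve.

Theorem theorem4p4 (L : language) (M S : structure L) (j : M -> S)
  (jel : elementary j) (oM : o_minimal M) (skM : definable_skolem M)
  (X Y : dspace M) (hY : hausdorff_space Y)
  (f : X -> Y) (fc : continuous f) (fd : definable_fun f) :
  let fS : ext_space jel (proj1 oM) X -> ext_space jel (proj1 oM) Y :=
    ext_map jel (proj1 oM) fd in
  definably_proper f <-> definably_proper fS.
Proof.
split=> [pf|]; last exact: proper_descends.
apply: (proper_of_curves (dlo_transfer jel (proj1 oM))).
- exact: ext_map_continuous.
- exact: ext_map_definable.
- exact: hausdorff_transfer.
apply/(curve_property_transfer fd (tr_subT jel _ X) (tr_subT jel _ Y)).
exact: curves_of_proper.
Qed.
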